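(* Let $R$ be an exceptional prime ring, and let $A$ be a noncentral additive subgroup of $R$ (i.e. $A\not\subseteq Z(R)$). Suppose that $[A,L]\subseteq A$, where $L$ is a nonabelian Lie ideal of $R$. Then the following hold: (i) $\beta Z(R)\subseteq A$ for some nonzero $\beta\in Z(R)$; (ii) either $AC=Ca+C$ for some $a\in A\setminus Z(R)$ with $a^2\in Z(R)$, or $[RC,RC]\subseteq AC$.
   Context: Rings are associative, not necessarily unital; $Z(R)$ is the center of $R$. $[a,b]:=ab-ba$; for additive subgroups $A,B$ of a ring, $AB$ (resp. $[A,B]$) is the additive subgroup generated by all $ab$ (resp. $[a,b]$), $a\in A$, $b\in B$. A Lie ideal of $R$ is an additive subgroup $L$ with $[L,R]\subseteq L$; it is abelian if $[L,L]=0$ and nonabelian otherwise. For a prime ring $R$, let $Q_s(R)$ be its Martindale symmetric ring of quotients and $C$ (the extended centroid) the center of $Q_s(R)$, which is a field; products such as $RC$, $AC$ are taken in $Q_s(R)$. A prime ring $R$ is called exceptional if both $\mathrm{char}\,R=2$ and $\dim_C RC=4$; in this case $RC$ is a central simple $C$-algebra (with $1$, so $C\subseteq RC$). *)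

(* Defs.v *)
From HB Require Import structures.
From mathcomp Require Import all_boot all_algebra.
From mathcomp Require Import generic_quotient.
From mathcomp Require Import mathcomp_extra boolp classical_sets.

Set Implicit Arguments.
Unset Strict Implicit.
Unset Printing Implicit Defensive.

Import GRing.Theory.

Local Open Scope classical_set_scope.
Local Open Scope quotient_scope.
Local Open Scope ring_scope.

Declare Scope rng_scope.
Delimit Scope rng_scope with rng.
Reserved Notation "x ** y" (at level 40, left associativity).

(* Associative rings, not necessarily unital: MathComp's rings all have a 1. *)

HB.mixin Record Zmodule_isRng R of GRing.Zmodule R := {
  rmul : R -> R -> R;
  rmulA : associative rmul;
  rmulDl : left_distributive rmul +%R;
  rmulDr : right_distributive rmul +%R
}.

#[short(type="rngType")]
HB.structure Definition Rng := {R of Zmodule_isRng R & GRing.Zmodule R}.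

Notation "x ** y" := (rmul x y) : rng_scope.
Local Open Scope rng_scope.

HB.mixin Record Rng_isPrime R of Rng R := {
  rng_neq0 : exists x : R, x <> 0;
  rng_prime : forall a b : R, (forall x, a ** x ** b = 0) -> a = 0 \/ b = 0
}.

#[short(type="primeRngType")]
HB.structure Definition PrimeRng := {R of Rng_isPrime R & Rng R}.

Section RngTheory.
Context {R : rngType}.
Implicit Types x y : R.

Lemma rmulr0 x : x ** 0 = 0.
Proof. by apply: (addrI (x ** 0)); rewrite -rmulDr !addr0. Qed.

Lemma rmul0r x : 0 ** x = 0.
Proof. by apply: (addrI (0 ** x)); rewrite -rmulDl !addr0. Qed.

Lemma rmulrN x y : x ** (- y) = - (x ** y).
Proof. by apply: (addrI (x ** y)); rewrite -rmulDr !subrr rmulr0. Qed.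

Lemma rmulNr x y : (- x) ** y = - (x ** y).
Proof. by apply: (addrI (x ** y)); rewrite -rmulDl !subrr rmul0r. Qed.

Lemma rmulrB x y z : x ** (y - z) = x ** y - x ** z.
Proof. by rewrite rmulDr rmulrN. Qed.

Lemma rmulBr x y z : (x - y) ** z = x ** z - y ** z.
Proof. by rewrite rmulDl rmulNr. Qed.
End RngTheory.

Section AdditiveSubgroups.
Context {R : rngType}.
Implicit Types (A B L I K V : set R).

Definition add_subgroup A := A 0 /\ forall x y, A x -> A y -> A (x - y).

Definition rcomm (x y : R) : R := x ** y - y ** x.

Definition prodset A B : set R :=
  smallest add_subgroup [set x ** y | x in A & y in B].

Definition commset A B : set R :=
  smallest add_subgroup [set rcomm x y | x in A & y in B].

Definition rcenter : set R := [set z | forall x, z ** x = x ** z].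

Definition lie_ideal L := add_subgroup L /\ commset L setT `<=` L.

Definition nonabelian L := commset L L <> [set 0].

Definition rideal I :=
  add_subgroup I /\ forall r x, I x -> I (r ** x) /\ I (x ** r).

Definition nz_ideal I := rideal I /\ exists2 x, I x & x <> 0.

(* [V] is meant to be a vector space over the central subfield [K] of [R]. *)
Definition has_dim K V (n : nat) := exists b : 'I_n -> R,
  [/\ forall i, V (b i),
      forall c : 'I_n -> R, (forall i, K (c i)) ->
        \sum_i c i ** b i = 0 -> forall i, c i = 0
    & forall v, V v -> exists2 c : 'I_n -> R,
        forall i, K (c i) & v = \sum_i c i ** b i].
End AdditiveSubgroups.

Arguments rcenter R : clear implicits.

(* The [n] with nR = 0 are the multiples of [p]; this also covers
   characteristic 0. *)
Definition has_char (R : rngType) (p : nat) :=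
  forall n : nat, (forall x : R, x *+ n = 0) <-> (p %| n)%N.

Section AddSubgroupTheory.
Context {R : rngType}.
Implicit Types (A B I : set R).

Lemma add_subgroup_smallest A : add_subgroup (smallest add_subgroup A).
Proof.
split=> [B [[B0 _] _] //|x y Ax Ay B BP].
by have [[_ sB] _] := BP; apply: sB; [apply: Ax | apply: Ay].
Qed.

Lemma add_subgroupN A x : add_subgroup A -> A x -> A (- x).
Proof. by move=> [A0 sA] Ax; rewrite -sub0r; apply: sA. Qed.

Lemma add_subgroupD A x y : add_subgroup A -> A x -> A y -> A (x + y).
Proof.
by move=> sA Ax Ay; rewrite -[y]opprK; apply: sA.2 => //; apply: add_subgroupN.
Qed.
End AddSubgroupTheory.

Section PrimeIdeals.
Context {R : primeRngType}.
Implicit Types (I J : set R).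

Lemma nz_idealT : nz_ideal [set: R].
Proof. by split=> //; have [x x0] := @rng_neq0 R; exists x. Qed.

Lemma rideal_prod I J : rideal I -> rideal J -> rideal (prodset I J).
Proof.
move=> [sI iI] [sJ iJ]; split; first exact: add_subgroup_smallest.
move=> r x IJx; split.
- apply: (@smallest_sub _ _ _ [set z | prodset I J (r ** z)]) x IJx.
    split=> [|u v] /=; first by rewrite rmulr0; apply: (add_subgroup_smallest _).1.
    by rewrite rmulrB; apply: (add_subgroup_smallest _).2.
  move=> _ [u Iu [v Jv <-]] /=; rewrite rmulA; apply: sub_gen_smallest.
  by exists (r ** u); [case: (iI r u Iu) | exists v].
- apply: (@smallest_sub _ _ _ [set z | prodset I J (z ** r)]) x IJx.
    split=> [|u v] /=; first by rewrite rmul0r; apply: (add_subgroup_smallest _).1.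
    by rewrite rmulBr; apply: (add_subgroup_smallest _).2.
  move=> _ [u Iu [v Jv <-]] /=; rewrite -rmulA; apply: sub_gen_smallest.
  by exists u => //; exists (v ** r) => //; case: (iJ r v Jv).
Qed.

Lemma nz_ideal_prod I J : nz_ideal I -> nz_ideal J -> nz_ideal (prodset I J).
Proof.
move=> [iI [x Ix x0]] [iJ [y Jy y0]]; split; first exact: rideal_prod.
have [r xry] : exists r, x ** r ** y <> 0.
  apply: contrapT => nr; have [r||] := @rng_prime R x y; last 2 first.
  - exact: x0.
  - exact: y0.
  by apply: contrapT => xry; apply: nr; exists r.
exists (x ** r ** y) => //; apply: sub_gen_smallest.
by exists (x ** r); [case: (iI.2 r x Ix) | exists y].
Qed.

Lemma sub_prod_l I J : rideal I -> prodset I J `<=` I.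
Proof.
move=> [sI iI]; apply: smallest_sub => // _ [u Iu [v _ <-]].
by case: (iI v u Iu).
Qed.

Lemma sub_prod_r I J : rideal J -> prodset I J `<=` J.
Proof.
move=> [sJ iJ]; apply: smallest_sub => // _ [u _ [v Jv <-]].
by case: (iJ u v Jv).
Qed.

Lemma nz_idealI I J : nz_ideal I -> nz_ideal J -> nz_ideal (I `&` J).
Proof.
move=> nI nJ; have [_ [x IJx x0]] := nz_ideal_prod nI nJ.
have [[[[I0 sI] iI] _] [[[J0 sJ] iJ] _]] := (nI, nJ); split; last first.
  by exists x => //; split; [apply: sub_prod_l IJx | apply: sub_prod_r IJx].
split=> [|r y [Iy Jy]].
  by split=> [//|u v [Iu Ju] [Iv Jv]]; split; [apply: sI | apply: sJ].
by have [[? ?] [? ?]] := (iI r y Iy, iJ r y Jy).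
Qed.
End PrimeIdeals.

(* The Martindale symmetric ring of quotients: classes of triples (f, g; I),
   I a nonzero ideal, f : I -> R right R-linear, g : I -> R left R-linear,
   balanced by x f(y) = g(x) y.  The class of (f, g; I) is the element q with
   q y = f(y) and x q = g(x) on I.  The values of [fl] and [fr] outside [dom]
   are irrelevant. *)
Record sympair (R : primeRngType) := SymPair {
  dom : set R;
  fl : R -> R;
  fr : R -> R;
  dom_nz : nz_ideal dom;
  flB : forall x y, dom x -> dom y -> fl (x - y) = fl x - fl y;
  flM : forall x r, dom x -> fl (x ** r) = fl x ** r;
  frB : forall x y, dom x -> dom y -> fr (x - y) = fr x - fr y;
  frM : forall r x, dom x -> fr (r ** x) = r ** fr x;
  fl_fr : forall x y, dom x -> dom y -> x ** fl y = fr x ** y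
}.

HB.instance Definition _ (R : primeRngType) := gen_eqMixin (sympair R).
HB.instance Definition _ (R : primeRngType) := gen_choiceMixin (sympair R).

Definition sym_equiv (R : primeRngType) (p q : sympair R) :=
  exists2 K : set R, nz_ideal K & forall x, K x ->
    [/\ dom p x, dom q x, fl p x = fl q x & fr p x = fr q x].

Section SymPairs.
Context {R : primeRngType}.
Implicit Types (p q : sympair R) (r : R).

Lemma sym_equiv_refl p : sym_equiv p p.
Proof. by exists (dom p); first exact: dom_nz. Qed.

Lemma sym_equiv_sym p q : sym_equiv p q -> sym_equiv q p.
Proof. by move=> [K nK h]; exists K => // x /h[]. Qed.

Lemma sym_equiv_trans p q s : sym_equiv p q -> sym_equiv q s -> sym_equiv p s.
Proof.
move=> [K nK h] [K' nK' h']; exists (K `&` K'); first exact: nz_idealI.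
by move=> x [/h[? ? -> ->] /h'[]].
Qed.

Definition sym_equivb p q := `[< sym_equiv p q >].

Lemma sym_equivb_equiv : equiv_class_of sym_equivb.
Proof.
split=> [p|p q|q p s].
- exact/asboolP/sym_equiv_refl.
- by apply/asboolP/asboolP => /sym_equiv_sym.
- by move=> /asboolP pq /asboolP qs; apply/asboolP/(sym_equiv_trans pq).
Qed.

Canonical sym_equivb_rel := EquivRelPack sym_equivb_equiv.

Lemma dom0 p : dom p 0. Proof. exact: (dom_nz p).1.1.1. Qed.

Lemma domB p x y : dom p x -> dom p y -> dom p (x - y).
Proof. exact: (dom_nz p).1.1.2. Qed.

Lemma domMl p r x : dom p x -> dom p (r ** x).
Proof. by case/((dom_nz p).1.2 r). Qed.

Lemma domMr p x r : dom p x -> dom p (x ** r).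
Proof. by case/((dom_nz p).1.2 r). Qed.

Lemma fl0 p : fl p 0 = 0.
Proof. by rewrite -(subrr 0) flB ?subrr//; apply: dom0. Qed.

Lemma fr0 p : fr p 0 = 0.
Proof. by rewrite -(subrr 0) frB ?subrr//; apply: dom0. Qed.

Lemma flD p x y : dom p x -> dom p y -> fl p (x + y) = fl p x + fl p y.
Proof.
move=> px py; have pNy : dom p (- y) by rewrite -sub0r; apply/domB/py/dom0.
by rewrite -{1}[y]opprK flB// -{1}[- y]sub0r flB ?fl0 ?sub0r ?opprK//; apply: dom0.
Qed.

Lemma frD p x y : dom p x -> dom p y -> fr p (x + y) = fr p x + fr p y.
Proof.
move=> px py; have pNy : dom p (- y) by rewrite -sub0r; apply/domB/py/dom0.
by rewrite -{1}[y]opprK frB// -{1}[- y]sub0r frB ?fr0 ?sub0r ?opprK//; apply: dom0.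
Qed.

(* An element of [prodset (dom q) I] is sent into [I] by [fl q], and an element
   of [prodset I (dom q)] by [fr q]. *)
Lemma fl_prod q I x : rideal I -> prodset (dom q) I x -> I (fl q x).
Proof.
move=> [sI iI] qIx; have iq := (dom_nz q).1.
suff [] : (dom q `&` [set z | I (fl q z)]) x by [].
move: x qIx; apply: smallest_sub.
  split=> [|u v [qu Iu] [qv Iv]].
    by split; [apply: dom0 | rewrite /= fl0; case: sI].
  by split; [apply: domB | rewrite /= flB//; apply: sI.2].
move=> _ [u qu [v Iv <-]]; split; first exact: domMr.
by rewrite /= flM//; case: (iI (fl q u) v Iv).
Qed.

Lemma fr_prod q I x : rideal I -> prodset I (dom q) x -> I (fr q x).
Proof.
move=> [sI iI] qIx.
suff [] : (dom q `&` [set z | I (fr q z)]) x by [].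
move: x qIx; apply: smallest_sub.
  split=> [|u v [qu Iu] [qv Iv]].
    by split; [apply: dom0 | rewrite /= fr0; case: sI].
  by split; [apply: domB | rewrite /= frB//; apply: sI.2].
move=> _ [u Iu [v qv <-]]; split; first exact: domMl.
by rewrite /= frM//; case: (iI (fr q v) u Iu).
Qed.

Local Obligation Tactic := idtac.

(* Multiplication by an element of [R]. *)
Program Definition sym_emb r : sympair R :=
  @SymPair R setT (fun y => r ** y) (fun x => x ** r) nz_idealT _ _ _ _ _.
Next Obligation. by move=> r x y _ _ /=; rewrite rmulrB. Qed.
Next Obligation. by move=> r x s _; rewrite /= rmulA. Qed.
Next Obligation. by move=> r x y _ _ /=; rewrite rmulBr. Qed.
Next Obligation. by move=> r s x _; rewrite /= rmulA. Qed.
Next Obligation. by move=> r x y _ _ /=; rewrite rmulA. Qed.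

Definition sym_one : sympair R.
Proof. by apply: (@SymPair R setT id id nz_idealT). Defined.

Program Definition sym_opp p : sympair R :=
  @SymPair R (dom p) (fun x => - fl p x) (fun x => - fr p x) (dom_nz p) _ _ _ _ _.
Next Obligation. by move=> p x y ? ?; rewrite /= flB// opprD. Qed.
Next Obligation. by move=> p x r ?; rewrite /= flM// rmulNr. Qed.
Next Obligation. by move=> p x y ? ?; rewrite /= frB// opprD. Qed.
Next Obligation. by move=> p r x ?; rewrite /= frM// rmulrN. Qed.
Next Obligation. by move=> p x y ? ?; rewrite /= rmulrN rmulNr fl_fr. Qed.

Program Definition sym_add p q : sympair R :=
  @SymPair R (dom p `&` dom q) (fun x => fl p x + fl q x)
    (fun x => fr p x + fr q x) (nz_idealI (dom_nz p) (dom_nz q)) _ _ _ _ _.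
Next Obligation. by move=> p q x y [? ?] [? ?]; rewrite /= !flB// opprD addrACA. Qed.
Next Obligation. by move=> p q x r [? ?]; rewrite /= !flM// rmulDl. Qed.
Next Obligation. by move=> p q x y [? ?] [? ?]; rewrite /= !frB// opprD addrACA. Qed.
Next Obligation. by move=> p q r x [? ?]; rewrite /= !frM// rmulDr. Qed.
Next Obligation. by move=> p q x y [? ?] [? ?]; rewrite /= rmulDl rmulDr !fl_fr. Qed.

Lemma sym_mul_dom p q x : prodset (dom q) (dom p) x ->
  [/\ dom p x, dom q x, dom p (fl q x) & dom q (fr p x)].
Proof.
move=> qpx; have [[ip _] [iq _]] := (dom_nz p, dom_nz q); split.
- exact: sub_prod_r qpx.
- exact: sub_prod_l qpx.
- exact: fl_prod qpx.
- exact: fr_prod qpx.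
Qed.

Program Definition sym_mul p q : sympair R :=
  @SymPair R (prodset (dom q) (dom p)) (fun x => fl p (fl q x))
    (fun x => fr q (fr p x)) (nz_ideal_prod (dom_nz q) (dom_nz p)) _ _ _ _ _.
Next Obligation.
move=> p q x y /sym_mul_dom[? ? ? ?] /sym_mul_dom[? ? ? ?].
by rewrite /= (flB (s:=q))// flB.
Qed.
Next Obligation.
by move=> p q x r /sym_mul_dom[? ? ? ?]; rewrite /= (flM (s:=q))// flM.
Qed.
Next Obligation.
move=> p q x y /sym_mul_dom[? ? ? ?] /sym_mul_dom[? ? ? ?].
by rewrite /= (frB (s:=p))// frB.
Qed.
Next Obligation.
by move=> p q r x /sym_mul_dom[? ? ? ?]; rewrite /= (frM (s:=p))// frM.
Qed.
Next Obligation.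
move=> p q x y /sym_mul_dom[? ? ? ?] /sym_mul_dom[? ? ? ?].
by rewrite /= fl_fr// fl_fr.
Qed.

Lemma sym_opp_equiv p p' : sym_equiv p p' -> sym_equiv (sym_opp p) (sym_opp p').
Proof. by move=> [K nK h]; exists K => // x /h[? ? /= -> ->]. Qed.

Lemma sym_add_equiv p p' q q' : sym_equiv p p' -> sym_equiv q q' ->
  sym_equiv (sym_add p q) (sym_add p' q').
Proof.
move=> [K nK h] [K' nK' h']; exists (K `&` K'); first exact: nz_idealI.
by move=> x [/h[? ? ep ep'] /h'[? ? eq eq']]; split=> //=; congr (_ + _).
Qed.

Lemma prodset_sub (I I' J J' : set R) :
  I `<=` I' -> J `<=` J' -> prodset I J `<=` prodset I' J'.
Proof.
move=> sI sJ; apply: smallest_sub; first exact: add_subgroup_smallest.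
move=> _ [u /sI Iu [v /sJ Jv <-]]; apply: sub_gen_smallest.
by exists u => //; exists v.
Qed.

Lemma sym_mul_equiv p p' q q' : sym_equiv p p' -> sym_equiv q q' ->
  sym_equiv (sym_mul p q) (sym_mul p' q').
Proof.
move=> [K nK h] [K' nK' h']; exists (prodset K' K); first exact: nz_ideal_prod.
have [sp sp' sq sq'] :
    [/\ K `<=` dom p, K `<=` dom p', K' `<=` dom q & K' `<=` dom q'].
  by split=> x => [/h|/h|/h'|/h'] [].
move=> x K'Kx; have Kx := sub_prod_r nK.1 K'Kx; have K'x := sub_prod_l nK'.1 K'Kx.
have [_ _ _ epx] := h x Kx; have [_ _ eqx _] := h' x K'x.
have qKx : prodset (dom q) K x by apply: prodset_sub K'Kx.
have pKx : prodset K' (dom p) x by apply: prodset_sub K'Kx.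
split=> /=.
- exact: prodset_sub K'Kx.
- exact: prodset_sub K'Kx.
- by rewrite -eqx; case: (h _ (fl_prod nK.1 qKx)).
- by rewrite -epx; case: (h' _ (fr_prod nK'.1 pKx)).
Qed.
End SymPairs.

Definition Qs (R : primeRngType) := {eq_quot @sym_equivb R}.
HB.instance Definition _ (R : primeRngType) := Choice.on (Qs R).

Section MartindaleRing.
Context {R : primeRngType}.
Implicit Types (p q s : sympair R) (x y z : Qs R).

Definition Qpi p : Qs R := \pi_({eq_quot @sym_equivb R}) p.
Definition Qrepr x : sympair R := repr (x : {eq_quot @sym_equivb R}).

Lemma Qpi_eq p q : Qpi p = Qpi q <-> sym_equiv p q.
Proof.
split=> [/(@eqmodP _ sym_equivb_rel)/asboolP//|pq].
by apply/(@eqmodP _ sym_equivb_rel)/asboolP.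
Qed.

Lemma QreprK x : Qpi (Qrepr x) = x. Proof. exact: reprK. Qed.

Lemma Qrepr_equiv p : sym_equiv (Qrepr (Qpi p)) p.
Proof. by apply/Qpi_eq; rewrite QreprK. Qed.

Definition Qadd x y := Qpi (sym_add (Qrepr x) (Qrepr y)).
Definition Qmul x y := Qpi (sym_mul (Qrepr x) (Qrepr y)).
Definition Qopp x := Qpi (sym_opp (Qrepr x)).

Lemma Qpi_add p q : Qadd (Qpi p) (Qpi q) = Qpi (sym_add p q).
Proof. by apply/Qpi_eq/sym_add_equiv; apply: Qrepr_equiv. Qed.

Lemma Qpi_mul p q : Qmul (Qpi p) (Qpi q) = Qpi (sym_mul p q).
Proof. by apply/Qpi_eq/sym_mul_equiv; apply: Qrepr_equiv. Qed.

Lemma Qpi_opp p : Qopp (Qpi p) = Qpi (sym_opp p).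
Proof. by apply/Qpi_eq/sym_opp_equiv/Qrepr_equiv. Qed.

Lemma Qpi_eqI p q :
  (forall x : R, dom p x -> dom q x -> fl p x = fl q x /\ fr p x = fr q x) ->
  Qpi p = Qpi q.
Proof.
move=> h; apply/Qpi_eq; exists (dom p `&` dom q).
  by apply: nz_idealI; apply: dom_nz.
by move=> x [px qx]; have [] := h x px qx.
Qed.

Lemma QaddA : associative Qadd.
Proof.
move=> x y z; rewrite -[x]QreprK -[y]QreprK -[z]QreprK !Qpi_add.
by apply: Qpi_eqI => u _ _ /=; rewrite !addrA.
Qed.

Lemma QaddC : commutative Qadd.
Proof.
move=> x y; rewrite -[x]QreprK -[y]QreprK !Qpi_add.
by apply: Qpi_eqI => u _ _ /=; split; apply: addrC.
Qed.

Lemma Qadd0 : left_id (Qpi (sym_emb 0)) Qadd.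
Proof.
move=> x; rewrite -[x]QreprK !Qpi_add.
by apply: Qpi_eqI => u _ _ /=; rewrite rmul0r rmulr0 !add0r.
Qed.

Lemma QaddN : left_inverse (Qpi (sym_emb 0)) Qopp Qadd.
Proof.
move=> x; rewrite -[x]QreprK Qpi_opp !Qpi_add.
by apply: Qpi_eqI => u _ _ /=; rewrite rmul0r rmulr0 !addNr.
Qed.

Lemma QmulA : associative Qmul.
Proof.
by move=> x y z; rewrite -[x]QreprK -[y]QreprK -[z]QreprK !Qpi_mul; apply: Qpi_eqI.
Qed.

Lemma Qmul1 : left_id (Qpi sym_one) Qmul.
Proof. by move=> x; rewrite -[x]QreprK !Qpi_mul; apply: Qpi_eqI. Qed.

Lemma Qmulr1 : right_id (Qpi sym_one) Qmul.
Proof. by move=> x; rewrite -[x]QreprK !Qpi_mul; apply: Qpi_eqI. Qed.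

Lemma QmulDl : left_distributive Qmul Qadd.
Proof.
move=> x y z; rewrite -[x]QreprK -[y]QreprK -[z]QreprK !(Qpi_add, Qpi_mul).
apply: Qpi_eqI => u _ [/sym_mul_dom[? ? ? ?] /sym_mul_dom[? ? ? ?]] /=.
by rewrite frD.
Qed.

Lemma QmulDr : right_distributive Qmul Qadd.
Proof.
move=> x y z; rewrite -[x]QreprK -[y]QreprK -[z]QreprK !(Qpi_add, Qpi_mul).
apply: Qpi_eqI => u _ [/sym_mul_dom[? ? ? ?] /sym_mul_dom[? ? ? ?]] /=.
by rewrite flD.
Qed.
End MartindaleRing.

HB.instance Definition _ (R : primeRngType) :=
  GRing.isZmodule.Build (Qs R) QaddA QaddC Qadd0 QaddN.
HB.instance Definition _ (R : primeRngType) :=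
  GRing.Zmodule_isPzRing.Build (Qs R) QmulA Qmul1 Qmulr1 QmulDl QmulDr.
HB.instance Definition _ (R : primeRngType) :=
  Zmodule_isRng.Build (Qs R) QmulA QmulDl QmulDr.

Definition Qemb (R : primeRngType) (r : R) : Qs R := Qpi (sym_emb r).

Section Embedding.
Context {R : primeRngType}.

Lemma QembB : {morph @Qemb R : r s / r - s}.
Proof.
move=> r s; have -> : Qemb r - Qemb s = Qadd (Qemb r) (Qopp (Qemb s)) by [].
rewrite Qpi_opp Qpi_add.
by apply: Qpi_eqI => x _ _ /=; rewrite rmulBr rmulrB.
Qed.

Lemma QembM : {morph @Qemb R : r s / r ** s}.
Proof.
move=> r s; have -> : Qemb r ** Qemb s = Qmul (Qemb r) (Qemb s) by [].
by rewrite Qpi_mul; apply: Qpi_eqI => x _ _ /=; rewrite !rmulA.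
Qed.

Lemma Qemb_inj : injective (@Qemb R).
Proof.
move=> r s /Qpi_eq[K [[_ iK] [x Kx x0]] h].
have [|//|/eqP] := @rng_prime R (r - s) x; last 2 first.
- by move=> rs0; apply/eqP; rewrite -subr_eq0 rs0.
- by move/eqP.
move=> y; rewrite -rmulA rmulBr; apply/eqP; rewrite subr_eq0; apply/eqP.
by have [_ _ /=] := h _ (iK y x Kx).1.
Qed.

Lemma Qpi_emb (p : sympair R) y : dom p y -> Qpi p ** Qemb y = Qemb (fl p y).
Proof.
move=> py; have -> : Qpi p ** Qemb y = Qmul (Qpi p) (Qemb y) by [].
rewrite Qpi_mul; apply: Qpi_eqI => x /sym_mul_dom[px _ _ _] _ /=.
by rewrite flM// fl_fr.
Qed.

Lemma emb_Qpi (p : sympair R) x : dom p x -> Qemb x ** Qpi p = Qemb (fr p x).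
Proof.
move=> px; have -> : Qemb x ** Qpi p = Qmul (Qemb x) (Qpi p) by [].
rewrite Qpi_mul; apply: Qpi_eqI => y /sym_mul_dom[_ py _ _] _ /=.
by rewrite frM// fl_fr.
Qed.
End Embedding.

Definition ext_centroid (R : primeRngType) : set (Qs R) := rcenter (Qs R).
Arguments ext_centroid R : clear implicits.

(* The product AC in [Qs R], for a subset A of R. *)
Definition scalC (R : primeRngType) (A : set R) : set (Qs R) :=
  prodset (@Qemb R @` A) (ext_centroid R).

Definition exceptional (R : primeRngType) :=
  has_char R 2 /\ has_dim (ext_centroid R) (scalC [set: R]) 4.

(* Main.v *)
(* Write C for the extended centroid and S = RC.  In dimension 4 and
   characteristic 2, S need not be split: it is enough to have a noncentral
   e in S with e^2 + e in C whose centralizer in S is contained in C + Ce.  As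
   (ad e)^2 = ad e, S is then the sum of that centralizer and of V, the image of
   ad e; products of two elements of V lie in C + Ce, so that squares, and
   hence commutators, of elements of V are central.  The commutator thus is an
   alternating C-valued form on V, nondegenerate by primeness, and V is a plane.
   All statements about subspaces of S stable under [-, V] reduce to linear
   algebra in the line C, the plane V and e: such a subspace lies in
   C, equals Ca + C with a^2 in C, or contains C + V = [S, S].

   To find e, Brauer's lemma gives a nonzero idempotent f of S.  If f <> 1, then
   f works.  If f = 1, every x in S is quadratic over C; were x^2 always central,
   so would be [x, y] and x [x, y] = [x, xy], and S would be commutative.

   For (i), [a, [u, r]] is a nonzero central element for suitable a in A, u in L
   and r in R, and z [a, [u, r]] = [a, [u, rz]] for z in Z(R). *)

Require Import Defs.
From HB Require Import structures.
From mathcomp Require Import all_boot all_algebra.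
From mathcomp Require Import mathcomp_extra boolp classical_sets.

Set Implicit Arguments.
Unset Strict Implicit.
Unset Printing Implicit Defensive.

Import GRing.Theory.

Local Open Scope classical_set_scope.
Local Open Scope ring_scope.
Local Open Scope rng_scope.

(** * The symmetric ring of quotients *)

Section MartindaleFacts.
Context {R : primeRngType}.
Implicit Types (I : set R) (r x y : R) (p q c : Qs R).

Lemma ideal_faithfull I x : nz_ideal I -> (forall y, I y -> x ** y = 0) -> x = 0.
Proof.
move=> [[_ iI] [y Iy y0]] xI; have [r||//] := @rng_prime R x y; last by [].
by rewrite -rmulA; apply: xI; have [] := iI r y Iy.
Qed.

Lemma ideal_faithfulr I x : nz_ideal I -> (forall y, I y -> y ** x = 0) -> x = 0.
Proof.
move=> [[_ iI] [y Iy y0]] Ix; have [r|//|//] := @rng_prime R y x.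
by apply: Ix; have [] := iI r y Iy.
Qed.

(** The balance relation x f(y) = g(x) y turns f = 0 into g(x) I = 0, and a nonzero ideal I is
    faithful. *)
Lemma Qpi_fl_eq0 (s : sympair R) : (forall y, dom s y -> fl s y = 0) -> Qpi s = 0.
Proof.
move=> s0; apply: Qpi_eqI => x sx _ /=; rewrite rmul0r rmulr0; split; first exact: s0.
by apply: (ideal_faithfull (dom_nz s)) => y sy; rewrite -fl_fr// s0// rmulr0.
Qed.

Lemma Qpi_fr_eq0 (s : sympair R) : (forall y, dom s y -> fr s y = 0) -> Qpi s = 0.
Proof.
move=> s0; apply: Qpi_fl_eq0 => x sx.
by apply: (ideal_faithfulr (dom_nz s)) => y sy; rewrite fl_fr// s0// rmul0r.
Qed.

Lemma Qemb0 : Qemb (0 : R) = 0. Proof. by []. Qed.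

Lemma Qemb_eq0 x : Qemb x = 0 -> x = 0.
Proof. by rewrite -Qemb0 => /Qemb_inj. Qed.

Lemma QembMr x y : Qemb (x ** y) = Qemb x * Qemb y. Proof. exact: QembM. Qed.

Lemma QembD x y : Qemb (x + y) = Qemb x + Qemb y.
Proof. by rewrite -[y in LHS]opprK -[- y]sub0r !QembB Qemb0 sub0r opprK. Qed.

Lemma QsM p q : p ** q = p * q. Proof. by []. Qed.

(** Choosing y and z in the domains with y p and q z nonzero brings the question into R, where y p R
    q z = 0 contradicts primeness. *)
Lemma Qs_prime p q : (forall r, p * Qemb r * q = 0) -> p = 0 \/ q = 0.
Proof.
rewrite -[p]QreprK -[q]QreprK; move: (Qrepr p) (Qrepr q) => s t st0.
apply: contrapT => /not_orP[s0 t0].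
have [y sy y0] : exists2 y, dom s y & fr s y <> 0.
  apply: contrapT => sy; apply/s0/Qpi_fr_eq0 => y ys.
  by apply: contrapT => y0; apply: sy; exists y.
have [z tz z0] : exists2 z, dom t z & fl t z <> 0.
  apply: contrapT => tz; apply/t0/Qpi_fl_eq0 => z zt.
  by apply: contrapT => z0; apply: tz; exists z.
have [r||] := @rng_prime R (fr s y) (fl t z); [|by []..].
apply: Qemb_eq0; rewrite 2!QembM -(emb_Qpi sy) -(Qpi_emb tz).
have -> : Qemb y ** Qpi s ** Qemb r ** (Qpi t ** Qemb z) =
  Qemb y * (Qpi s * Qemb r * Qpi t) * Qemb z by rewrite !QsM !mulrA.
by rewrite st0 mulr0 mul0r.
Qed.

Lemma Qs_faithful I q : nz_ideal I -> (forall y, I y -> q * Qemb y = 0) -> q = 0.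
Proof.
move=> [[_ iI] [y Iy y0]] qI; have [r|//|y0Q] := @Qs_prime q (Qemb y);
  last by case: y0; apply: Qemb_eq0.
by rewrite -mulrA -QembMr; apply: qI; have [] := iI r y Iy.
Qed.

(** For y in the domain of x, x y lies in R, so q x y = x y q = x q y; hence q x - x q kills a
    nonzero ideal. *)
Lemma Qs_central q : (forall r, q * Qemb r = Qemb r * q) -> ext_centroid R q.
Proof.
move=> qR x; apply/subr0_eq; rewrite -[x]QreprK; move: (Qrepr x) => s.
apply: (Qs_faithful (dom_nz s)) => y sy; rewrite mulrBl.
have -> : q ** Qpi s * Qemb y = q * (Qpi s ** Qemb y) by rewrite mulrA.
have -> : Qpi s ** q * Qemb y = Qpi s ** Qemb y * q.
  by rewrite /= -[Qpi s ** q]/(Qpi s * q) -mulrA qR mulrA.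
by rewrite Qpi_emb// qR subrr.
Qed.

Lemma rcenter_Qemb r : rcenter R r <-> ext_centroid R (Qemb r).
Proof.
split=> [rZ|rZ x]; last by apply: Qemb_inj; rewrite !QembM.
by apply: Qs_central => x; rewrite -!QembMr rZ.
Qed.

(** Multiplication by c is injective on its domain I, by primeness, and linear on both sides, by
    centrality. Its inverse on the ideal c I therefore serves as both the left and the right
    component of d. *)
Lemma ext_centroid_inv c : ext_centroid R c -> c <> 0 ->
  exists2 d, ext_centroid R d & c * d = 1.
Proof.
move=> cZ c0; have [s cE] : exists s, c = Qpi s by exists (Qrepr c); rewrite QreprK.
have cs y : dom s y -> Qemb (fl s y) = c * Qemb y by rewrite cE => /Qpi_emb <-.
have cI x y : c * Qemb x = c * Qemb y -> x = y.
  move=> cxy; apply/subr0_eq/Qemb_eq0.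
  have [r|/c0//|//] := @Qs_prime c (Qemb (x - y)).
  by rewrite [c * _]cZ -[_ ** c]/(_ * c) -mulrA QembB mulrBr cxy subrr mulr0.
have flI x y : dom s x -> dom s y -> fl s x = fl s y -> x = y.
  by move=> sx sy /(congr1 (@Qemb R)); rewrite !cs// => /cI.
have flMl r x : dom s x -> fl s (r ** x) = r ** fl s x.
  move=> sx; apply: Qemb_inj; rewrite QembMr !cs//; last exact: domMl.
  by rewrite QembMr !mulrA; congr (_ * _); apply: cZ.
pose J := [set fl s y | y in dom s].
have nJ : nz_ideal J.
  split; first split; first split.
  - by exists 0; [exact: dom0 | exact: fl0].
  - by move=> _ _ [x sx <-] [y sy <-]; exists (x - y); [exact: domB | exact: flB].
  - move=> r _ [x sx <-]; split; first by exists (r ** x); [exact: domMl | exact: flMl].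
    by exists (x ** r); [exact: domMr | exact: flM].
  - have [_ [y sy y0]] := dom_nz s; exists (fl s y); first by exists y.
    by move=> sy0; apply/y0/flI => //; [exact: dom0 | rewrite sy0 fl0].
(* The default 0 is taken only outside [J], where the values are irrelevant. *)
pose g x := xget 0 [set y | dom s y /\ fl s y = x].
have gfl y : dom s y -> g (fl s y) = y.
  move=> sy; rewrite /g; case: xgetP => [z _ [sz zy]|/(_ y) []//].
  exact: flI.
have gB x y : J x -> J y -> g (x - y) = g x - g y.
  by move=> [u su <-] [v sv <-]; rewrite -flB// !gfl//; apply: domB.
have gMr x r : J x -> g (x ** r) = g x ** r.
  by move=> [u su <-]; rewrite -flM// !gfl//; apply: domMr.
have gMl r x : J x -> g (r ** x) = r ** g x.
  by move=> [u su <-]; rewrite -flMl// !gfl//; apply: domMl.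
have gg x y : J x -> J y -> x ** g y = g x ** y.
  by move=> Jx [v sv <-]; rewrite gfl// -{1}(gfl _ sv) -gMl; last exact: imageP; rewrite gMr.
pose d := Qpi (SymPair nJ gB gMr gB gMl gg).
have dc : d * c = 1.
  apply/subr0_eq/(Qs_faithful (dom_nz s)) => y sy.
  rewrite mulrBl mul1r -mulrA -cs// -[d * _]/(d ** _) Qpi_emb /=; last by exists y.
  by rewrite gfl// subrr.
have cd : c * d = 1 by rewrite -dc; apply: cZ.
(* d is central because d x = d x c d = d c x d = x d. *)
exists d => // x; rewrite -[_ ** _]/(d * x) -[RHS]/(x * d).
by rewrite -[LHS]mulr1 -cd -[d * x * _]mulrA [x * _]mulrA -[x * c]/(x ** c) -cZ
  -[c ** x]/(c * x) !mulrA dc mul1r.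
Qed.

Lemma Qs_1_neq0 : (1 : Qs R) <> 0.
Proof.
move=> e; have [x x0] := @rng_neq0 R.
by apply/x0/Qemb_eq0; rewrite -[LHS]mulr1 e mulr0.
Qed.

Lemma Qs_char2 q : has_char R 2 -> q + q = 0.
Proof.
move=> R2; apply: (Qs_faithful nz_idealT) => y _.
rewrite mulrDl -mulrDr -QembD -mulr2n (R2 2).2//.
by rewrite Qemb0 mulr0.
Qed.
End MartindaleFacts.

(** * Linear algebra over a central subfield *)

Section CentralSpan.
Context (F : fieldType) (Q : pzRingType) (iota : {rmorphism F -> Q}).
Context (n : nat) (b : 'I_n -> Q).
Implicit Types (c d : 'rV[F]_n) (x y s : Q).

(** Scalars come from a [fieldType] through [iota] rather than from a predicate on Q, so that
    coordinates are row vectors and matrix rank is available. *)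
Definition lincomb c : Q := \sum_i iota (c 0 i) * b i.

Lemma lincombZD a c d : lincomb (a *: c + d) = iota a * lincomb c + lincomb d.
Proof.
rewrite /lincomb big_distrr -big_split; apply: eq_bigr => i _ /=.
by rewrite !mxE rmorphD rmorphM mulrDl mulrA.
Qed.

Lemma lincomb0 : lincomb 0 = 0.
Proof. by rewrite /lincomb big1// => i _; rewrite mxE rmorph0 mul0r. Qed.

Lemma lincombD c d : lincomb (c + d) = lincomb c + lincomb d.
Proof. by rewrite -[c]scale1r lincombZD rmorph1 mul1r scale1r. Qed.

Lemma lincombZ a c : lincomb (a *: c) = iota a * lincomb c.
Proof. by rewrite -[a *: c]addr0 lincombZD lincomb0 addr0. Qed.

Lemma lincombB c d : lincomb (c - d) = lincomb c - lincomb d.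
Proof. by rewrite addrC -scaleN1r lincombZD rmorphN1 mulN1r addrC. Qed.

Lemma lincomb_delta i : lincomb (delta_mx 0 i) = b i.
Proof.
rewrite /lincomb (bigD1 i)//= big1 ?addr0; first by rewrite mxE !eqxx rmorph1 mul1r.
by move=> j ji; rewrite mxE (negbTE ji) andbF rmorph0 mul0r.
Qed.

Lemma lincomb_mulmx m (c : 'rV[F]_m) (M : 'M[F]_(m, n)) :
  lincomb (c *m M) = \sum_i iota (c 0 i) * lincomb (row i M).
Proof.
rewrite mulmx_sum_row (big_morph lincomb lincombD lincomb0).
by apply: eq_bigr => i _; rewrite lincombZ.
Qed.

Let S : set Q := [set x | exists c, x = lincomb c].

(** The coordinates of the [s i] form a square matrix; freeness makes its rows independent, so it is
    invertible. *)
Lemma free_spans (s : 'I_n -> Q) : (forall i, S (s i)) ->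
  (forall c, \sum_i iota (c 0 i) * s i = 0 -> c = 0) ->
  forall x, S x -> exists c, x = \sum_i iota (c 0 i) * s i.
Proof.
move=> /choice[m sE] s_free _ [d ->].
pose M := \matrix_i m i.
have sM c : \sum_i iota (c 0 i) * s i = lincomb (c *m M).
  by rewrite lincomb_mulmx; apply: eq_bigr => i _; rewrite rowK -sE.
have uM : M \in unitmx.
  rewrite -row_free_unit; apply: inj_row_free => c cM.
  by apply: s_free; rewrite sM cM lincomb0.
by exists (d *m invmx M); rewrite sM mulmxKV.
Qed.

Hypothesis b_free : forall c, lincomb c = 0 -> c = 0.

Lemma lincomb_inj : injective lincomb.
Proof.
move=> c d /eqP; rewrite -subr_eq0 => /eqP cd0.
by apply/subr0_eq/b_free; rewrite lincombB.
Qed.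

Hypothesis iotaC : forall a (x : Q), iota a * x = x * iota a.
Hypothesis S_mul : forall x y, S x -> S y -> S (x * y).
Hypothesis S_prime : forall x y, (forall s, S s -> x * s * y = 0) -> x = 0 \/ y = 0.

(* Brauer's lemma for a right ideal [x0 S] of least dimension. *)
Lemma ex_idempotent : (exists2 x, S x & x <> 0) ->
  exists e, [/\ S e, e <> 0 & e * e = e].
Proof.
move=> [x1 Sx1 x1_neq0].
have Sb i : S (b i) by exists (delta_mx 0 i); rewrite lincomb_delta.
(* Left multiplication by x is right multiplication of coordinate rows by [M], so the rank of [M] is
   the dimension of x S. *)
have lmx x : S x -> exists M : 'M[F]_n, forall c, x * lincomb c = lincomb (c *m M).
  move=> Sx; have /choice[m mE] i := S_mul Sx (Sb i).
  exists (\matrix_i m i) => c; rewrite lincomb_mulmx mulr_sumr.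
  by apply: eq_bigr => i _; rewrite rowK -mE mulrA -iotaC mulrA.
pose rk k := `[< exists x (M : 'M[F]_n), [/\ S x, x <> 0, \rank M = k &
  forall c, x * lincomb c = lincomb (c *m M)] >].
have rk_ex : exists k, rk k.
  by have [M ME] := lmx _ Sx1; exists (\rank M); apply/asboolP; exists x1, M.
have [_ /asboolP[x0 [M0 [Sx0 x0_neq0 <- M0E]]] min] := ex_minnP rk_ex.
pose rho := [set x | exists2 s, S s & x = x0 * s].
have rhoM p t : rho p -> S t -> rho (p * t).
  by move=> [s Ss ->] St; exists (s * t); [exact: S_mul | rewrite mulrA].
have rhoS p : rho p -> S p by move=> [s Ss ->]; exact: S_mul.
(* Every nonzero p in x0 S generates it: p S is contained in x0 S and, by minimality, has at least
   its dimension. *)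
have rho_min p q : rho p -> p <> 0 -> rho q -> exists2 u, S u & q = p * u.
  move=> [s Ss pE] p0 [_ [d ->] ->]; have Sp : S p by rewrite pE; exact: S_mul.
  have [M ME] := lmx _ Sp.
  have MM0 : (M <= M0)%MS.
    apply/row_subP => i; have [c cE] := S_mul Ss (Sb i).
    apply/submxP; exists c; apply: lincomb_inj; rewrite -M0E -cE mulrA -pE.
    by rewrite -lincomb_delta ME -rowE.
  have M0M : (M0 <= M)%MS.
    rewrite -(geq_leqif (mxrank_leqif_sup MM0)); apply: min; apply/asboolP.
    by exists p, M.
  have /submxP[c cE] : (d *m M0 <= M)%MS by apply: submx_trans M0M; apply: submxMl.
  by exists (lincomb c); [exists c | rewrite M0E cE ME].
(* Applying primeness twice yields x and p in x0 S with x p nonzero. *)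
have [s Ss x0sx0] : exists2 s, S s & x0 * s * x0 <> 0.
  apply: contrapT => ns; have [s Ss|//|//] := @S_prime x0 x0.
  by apply: contrapT => s0; apply: ns; exists s.
have [t St xp0] : exists2 t, S t & x0 * s * (x0 * t) <> 0.
  apply: contrapT => nt; have [t St|//|//] := @S_prime (x0 * s * x0) x1.
  suff -> : x0 * s * x0 * t = 0 by rewrite mul0r.
  by apply: contrapT => t0; apply: nt; exists t => //; rewrite mulrA.
set x := x0 * s in xp0; set p := x0 * t in xp0.
have [rx rp] : rho x /\ rho p by split; [exists s | exists t].
(* As x p generates x0 S, x = x p u; the idempotent will be e = p u, for which x e = x. *)
have [u Su xE] := rho_min _ _ (rhoM _ _ rx (rhoS _ rp)) xp0 rx.
have re : rho (p * u) by exact: rhoM.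
exists (p * u); split; first exact: rhoS.
  by move=> e0; apply: xp0; rewrite xE -[x * p * u]mulrA e0 mulr0 mul0r.
(* For k = e^2 - e, x k = 0; a nonzero k would generate x0 S, which contains p, and x p would
   vanish. *)
apply/subr0_eq; pose k := p * u * (p * u) - p * u; apply: contrapT; rewrite -/k => k0.
have rk' : rho k.
  have [d1 [c1 ->] e1] := rhoM _ _ re (rhoS _ re).
  have [d2 [c2 ->] e2] := re.
  exists (lincomb (c1 - c2)); first by exists (c1 - c2).
  by rewrite lincombB mulrBr -e1 -e2.
have [v Sv pE] := rho_min _ _ rk' k0 rp.
have xeE : x * (p * u) = x by rewrite mulrA -xE.
by apply: xp0; rewrite pE mulrA /k mulrBr [x * (p * u * _)]mulrA !xeE subrr mul0r.
Qed.
End CentralSpan.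

(** * The extended centroid as a field *)

Lemma ext_centroid1 (R : primeRngType) : ext_centroid R 1.
Proof. by move=> x; rewrite !QsM mulr1 mul1r. Qed.

Lemma ext_centroidD (R : primeRngType) (c d : Qs R) :
  ext_centroid R c -> ext_centroid R d -> ext_centroid R (c + d).
Proof. by move=> cZ dZ x; rewrite rmulDl rmulDr cZ dZ. Qed.

Lemma ext_centroidN (R : primeRngType) (c : Qs R) :
  ext_centroid R c -> ext_centroid R (- c).
Proof. by move=> cZ x; rewrite rmulNr rmulrN cZ. Qed.

Lemma ext_centroid0 (R : primeRngType) : ext_centroid R 0.
Proof. by move=> x; rewrite rmul0r rmulr0. Qed.

Lemma ext_centroidM (R : primeRngType) (c d : Qs R) :
  ext_centroid R c -> ext_centroid R d -> ext_centroid R (c * d).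
Proof. by move=> cZ dZ x; rewrite -[c * d]/(c ** d) -rmulA dZ rmulA cZ rmulA. Qed.

(** A subtype by a boolean predicate, so that equality of scalars is equality in [Qs R]; it is the
    field over which [lincomb] is used. *)
Definition centroid_field (R : primeRngType) := {c : Qs R | `[< ext_centroid R c >]}.
HB.instance Definition _ (R : primeRngType) := Choice.on (centroid_field R).

Section CentroidField.
Context {R : primeRngType}.
Local Notation F := (centroid_field R).
Implicit Types a b c : F.

Definition mkF (c : Qs R) (cZ : ext_centroid R c) : F := exist _ c (asboolT cZ).

Lemma valF a : ext_centroid R (sval a).
Proof. exact/asboolP/(svalP a). Qed.

Lemma valF_inj a b : sval a = sval b -> a = b.
Proof. exact: val_inj. Qed.

Definition addF a b := mkF (ext_centroidD (valF a) (valF b)).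
Definition oppF a := mkF (ext_centroidN (valF a)).
Definition zeroF : F := mkF (@ext_centroid0 R).
Definition mulF a b := mkF (ext_centroidM (valF a) (valF b)).
Definition oneF : F := mkF (@ext_centroid1 R).

Lemma addFA : associative addF.
Proof. by move=> a b c; apply: valF_inj; apply: addrA. Qed.
Lemma addFC : commutative addF.
Proof. by move=> a b; apply: valF_inj; apply: addrC. Qed.
Lemma add0F : left_id zeroF addF.
Proof. by move=> a; apply: valF_inj; apply: add0r. Qed.
Lemma addNF : left_inverse zeroF oppF addF.
Proof. by move=> a; apply: valF_inj; apply: addNr. Qed.
HB.instance Definition _ := GRing.isZmodule.Build F addFA addFC add0F addNF.

Lemma mulFA : associative mulF.
Proof. by move=> a b c; apply: valF_inj; apply: mulrA. Qed.
Lemma mulFC : commutative mulF.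
Proof. by move=> a b; apply: valF_inj; apply: (valF a). Qed.
Lemma mul1F : left_id oneF mulF.
Proof. by move=> a; apply: valF_inj; apply: mul1r. Qed.
Lemma mulFDl : left_distributive mulF +%R.
Proof. by move=> a b c; apply: valF_inj; apply: mulrDl. Qed.
Lemma oneF_neq0 : oneF != 0.
Proof. by apply/eqP => /(congr1 sval); apply: Qs_1_neq0. Qed.
HB.instance Definition _ :=
  GRing.Zmodule_isComNzRing.Build F mulFA mulFC mul1F mulFDl oneF_neq0.

Definition invF a : F := if a == 0 then 0 else xget 0 [set b | b * a = 1].
Lemma mulVF a : a != 0 -> invF a * a = 1.
Proof.
move=> a0; rewrite /invF (negbTE a0); case: xgetP => [b _ //|].
have [|d dZ ad] := ext_centroid_inv (valF a).
  by move=> e; case/eqP: a0; apply: valF_inj.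
move=> /(_ (mkF dZ)) []; apply: valF_inj; rewrite -[RHS]ad; exact: dZ.
Qed.
Lemma invF0 : invF 0 = 0. Proof. by rewrite /invF eqxx. Qed.
HB.instance Definition _ := GRing.ComNzRing_isField.Build F mulVF invF0.

Definition iotaF : F -> Qs R := sval.
HB.instance Definition _ :=
  GRing.isZmodMorphism.Build F (Qs R) iotaF (fun _ _ => erefl).
HB.instance Definition _ :=
  GRing.isMonoidMorphism.Build F (Qs R) iotaF (erefl, fun _ _ => erefl).
End CentroidField.

(** * The central closure *)

Section CentralClosure.
Context {R : primeRngType}.
Local Notation C := (ext_centroid R).
Local Notation RC := (scalC [set: R]).
Implicit Types x y s c : Qs R.

Lemma scalC_subgroup (A : set R) : add_subgroup (scalC A).
Proof. exact: add_subgroup_smallest. Qed.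

Lemma scalCD (A : set R) x y : scalC A x -> scalC A y -> scalC A (x + y).
Proof. exact: add_subgroupD (scalC_subgroup _). Qed.

Lemma scalCZ (A : set R) c x : C c -> scalC A x -> scalC A (c * x).
Proof.
move=> cZ; apply: (@smallest_sub _ _ _ [set x | scalC A (c * x)]) x => /=.
  split=> [|x y] /=; first by rewrite mulr0; apply: (scalC_subgroup A).1.
  by move=> Ax Ay; rewrite mulrBr; apply: (scalC_subgroup A).2.
move=> _ [_ [a Aa <-]] [d dZ <-] /=; apply: sub_gen_smallest.
exists (Qemb a); first by exists a.
exists (c * d); first exact: ext_centroidM.
by rewrite !QsM !mulrA -[c * _]/(c ** _) cZ.
Qed.

Lemma scalC_emb (A : set R) a : A a -> scalC A (Qemb a).
Proof.
move=> Aa; apply: sub_gen_smallest; exists (Qemb a); first by exists a.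
by exists 1; [exact: ext_centroid1 | rewrite QsM mulr1].
Qed.

Lemma scalC_ind (A : set R) (P : set (Qs R)) :
  add_subgroup P -> (forall c x, C c -> P x -> P (c * x)) ->
  (forall a, A a -> P (Qemb a)) -> scalC A `<=` P.
Proof.
move=> sP PZ PA; apply: smallest_sub => // _ [_ [a Aa <-]] [c cZ <-] /=.
by rewrite -cZ; apply: PZ => //; apply: PA.
Qed.

Lemma RC_mul x y : RC x -> RC y -> RC (x * y).
Proof.
have [RC0 RCB] := scalC_subgroup [set: R].
move=> RCx RCy; move: x RCx; apply: scalC_ind.
- split=> [|u v] /=; first by rewrite mul0r.
  by rewrite mulrBl; apply: RCB.
- by move=> c x cZ; rewrite -mulrA; apply: scalCZ.
- move=> a _; move: y RCy; apply: scalC_ind.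
  + split=> [|u v] /=; first by rewrite mulr0.
    by rewrite mulrBr; apply: RCB.
  + move=> c x cZ; rewrite mulrA -[_ * c]/(_ ** c) -cZ QsM -mulrA; exact: scalCZ.
  + by move=> r _; rewrite -QembMr; apply: scalC_emb.
Qed.

Lemma RC_prime x y : (forall s, RC s -> x * s * y = 0) -> x = 0 \/ y = 0.
Proof. by move=> xy; apply: Qs_prime => r; apply: xy; apply: scalC_emb. Qed.

Lemma RC_central x : (forall s, RC s -> x * s = s * x) -> C x.
Proof. by move=> xS; apply: Qs_central => r; apply: xS; apply: scalC_emb. Qed.

Lemma RC_dim_lincomb n : has_dim C RC n -> exists b : 'I_n -> Qs R,
  (forall c : 'rV[centroid_field R]_n, lincomb (@iotaF R) b c = 0 -> c = 0) /\
  RC = [set x | exists c : 'rV[centroid_field R]_n, x = lincomb (@iotaF R) b c].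
Proof.
move=> [b [RCb bfree bspan]]; exists b; split.
  move=> c /bfree c0; apply/rowP => i; rewrite mxE; apply: valF_inj.
  by apply: c0 => j; apply: valF.
apply/seteqP; split=> x.
  move=> /bspan[c cZ ->]; exists (\row_i mkF (cZ i)).
  by apply: eq_bigr => i _; rewrite mxE.
have sRC := scalC_subgroup [set: R].
move=> [c ->]; apply: big_ind => [|u v|i _].
- exact: sRC.1.
- exact: add_subgroupD.
- by apply: scalCZ => //; apply: valF.
Qed.

Lemma RC_idempotent n : has_dim C RC n -> exists e, [/\ RC e, e <> 0 & e * e = e].
Proof.
move=> /RC_dim_lincomb[b [bfree RCE]].
have := @ex_idempotent _ _ (@iotaF R) _ b bfree; rewrite -RCE; apply.
- by move=> a x; apply: (valF a).
- exact: RC_mul.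
- exact: RC_prime.
- have [r r0] := @rng_neq0 R; exists (Qemb r); first exact: scalC_emb.
  by move=> /Qemb_eq0.
Qed.

(** The form in which dimension 4 is used below: coordinates in any four independent elements, with
    scalars taken as members of C. *)
Lemma RC_dim4_spans s1 s2 s3 s4 : has_dim C RC 4 ->
  RC s1 -> RC s2 -> RC s3 -> RC s4 ->
  (forall c1 c2 c3 c4, C c1 -> C c2 -> C c3 -> C c4 ->
     c1 * s1 + c2 * s2 + c3 * s3 + c4 * s4 = 0 ->
     [/\ c1 = 0, c2 = 0, c3 = 0 & c4 = 0]) ->
  forall x, RC x -> exists c1 c2 c3 c4, [/\ C c1, C c2, C c3, C c4 &
     x = c1 * s1 + c2 * s2 + c3 * s3 + c4 * s4].
Proof.
move=> /RC_dim_lincomb[b [_ RCE]] RC1 RC2 RC3 RC4 sfree x RCx.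
pose s (i : 'I_4) := nth 0 [:: s1; s2; s3; s4] i.
have sumE (c : 'rV[centroid_field R]_4) : \sum_i iotaF (c 0 i) * s i =
    iotaF (c 0 (inord 0)) * s1 + iotaF (c 0 (inord 1)) * s2 +
    iotaF (c 0 (inord 2)) * s3 + iotaF (c 0 (inord 3)) * s4.
  rewrite 4!big_ord_recl big_ord0 addr0 !addrA.
  by do 3?congr (_ + _); congr (iotaF (c 0 _) * _); apply: val_inj; rewrite /= inordK.
have Ss i : exists c : 'rV[centroid_field R]_4, s i = lincomb (@iotaF R) b c.
  by move: RC1 RC2 RC3 RC4; rewrite RCE /s; case: i => [[|[|[|[|]]]]].
have s_free (c : 'rV[centroid_field R]_4) : \sum_i iotaF (c 0 i) * s i = 0 -> c = 0.
  rewrite sumE => /sfree[||||c0 c1 c2 c3]; try exact: valF.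
  apply/rowP => i; rewrite mxE; apply: valF_inj.
  by rewrite -[i]inord_val; case: i => [[|[|[|[|]]]]].
have [|c] := free_spans Ss s_free (x := x); first by move: RCx; rewrite RCE.
rewrite sumE => xE.
by do 4 eexists; split; last exact: xE; apply: valF.
Qed.
End CentralClosure.

(** * Four-dimensional central algebras in characteristic 2 *)

(** For Q = [Qs R] this is convertible to [ext_centroid R], so that the results on abstract Q and S
    apply directly to RC. *)
Definition central (Q : pzRingType) : set Q := [set c | forall x, c * x = x * c].

Lemma central0 (Q : pzRingType) : central (0 : Q).
Proof. by move=> x; rewrite mul0r mulr0. Qed.

Lemma centralD (Q : pzRingType) (c d : Q) : central c -> central d -> central (c + d).
Proof. by move=> cZ dZ x; rewrite mulrDl mulrDr cZ dZ. Qed.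

Lemma centralM (Q : pzRingType) (c d : Q) : central c -> central d -> central (c * d).
Proof. by move=> cZ dZ x; rewrite -mulrA dZ mulrA cZ mulrA. Qed.

Lemma centralCA (Q : pzRingType) (c x y : Q) : central c -> x * (c * y) = c * (x * y).
Proof. by move=> cZ; rewrite mulrA -cZ mulrA. Qed.

Section QuaternionChar2.
Context (Q : pzRingType) (S : set Q).
Implicit Types (a b c d s t u v w x y z : Q).
Local Notation C := (@central Q).

Hypothesis char2 : forall x, x + x = 0.
Hypothesis C_inv : forall c, C c -> c <> 0 -> exists2 d, C d & c * d = 1.
Hypothesis SD : forall x y, S x -> S y -> S (x + y).
Hypothesis SZ : forall c x, C c -> S x -> S (c * x).
Hypothesis SM : forall x y, S x -> S y -> S (x * y).
Hypothesis S_prime : forall x y, (forall s, S s -> x * s * y = 0) -> x = 0 \/ y = 0.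

Lemma add_eq0_char2 x y : x + y = 0 -> x = y.
Proof. by move=> xy0; apply: (addrI y); rewrite char2 addrC. Qed.

Lemma addKr_self x y : x + (x + y) = y.
Proof. by rewrite addrA char2 add0r. Qed.

Lemma addrK_self x y : y + x + x = y.
Proof. by rewrite -addrA char2 addr0. Qed.

Lemma char2_cancel x y : y = 0 -> x + (x + y) = 0.
Proof. by rewrite addKr_self. Qed.

Lemma char2_rotate x y z : x + (z + y) = 0 -> x + (y + z) = 0.
Proof. by rewrite [z + y]addrC. Qed.

(* Proves an identity whose two sides, once expanded, have every monomial
   occurring an even number of times in total. *)
Ltac char2_ring :=
  apply: add_eq0_char2; rewrite ?(mulrDl, mulrDr, mulr1, mul1r, mulrA, addr0, add0r);
  rewrite -?addrA;
  do 400?[first [exact: char2 | apply: char2_cancel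
                | apply: char2_rotate; rewrite -?addrA]].

Lemma scale_eq0 c x : C c -> c * x = 0 -> c = 0 \/ x = 0.
Proof.
move=> cZ cx0; case: (EM (c = 0)) => [|c0]; [by left|right].
have [d dZ cd] := C_inv cZ c0.
by rewrite -[x]mul1r -cd cZ -mulrA cx0 mulr0.
Qed.

Hypothesis S_central : forall x, (forall s, S s -> x * s = s * x) -> C x.
Hypothesis S_spans : forall s1 s2 s3 s4, S s1 -> S s2 -> S s3 -> S s4 ->
  (forall c1 c2 c3 c4, C c1 -> C c2 -> C c3 -> C c4 ->
     c1 * s1 + c2 * s2 + c3 * s3 + c4 * s4 = 0 ->
     [/\ c1 = 0, c2 = 0, c3 = 0 & c4 = 0]) ->
  forall x, S x -> exists c1 c2 c3 c4, [/\ C c1, C c2, C c3, C c4 &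
     x = c1 * s1 + c2 * s2 + c3 * s3 + c4 * s4].

(** The equation is of Artin-Schreier type, X^2 + X = c, which makes ad e idempotent. A central [e]
    satisfies the last clause only when S is commutative. *)
Definition separable_frame e := [/\ S e, C (e * e + e) &
  forall s, S s -> e * s = s * e -> exists a b, [/\ C a, C b & s = a + b * e]].

(* The four Peirce components of [f] are nonzero by primeness, hence lines. *)
Lemma idempotent_frame f : S f -> f * f = f -> f <> 0 -> f <> 1 -> separable_frame f.
Proof.
move=> Sf ff f0 f1; pose g := 1 + f.
have g0 : g <> 0 by move=> /add_eq0_char2 /esym.
have fg : f * g = 0 by rewrite mulrDr mulr1 ff char2.
have gf : g * f = 0 by rewrite mulrDl mul1r ff char2.
have gg : g * g = g by rewrite {2}/g mulrDr mulr1 gf addr0.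
have Sl x : S x -> S (g * x) by move=> Sx; rewrite mulrDl mul1r; apply: SD => //; apply: SM.
have Sr x : S x -> S (x * g) by move=> Sx; rewrite mulrDr mulr1; apply: SD => //; apply: SM.
have ex x y : x * x = x -> y * y = y -> x <> 0 -> y <> 0 ->
    (forall s, S s -> S (x * s)) -> (forall s, S s -> S (s * y)) ->
    exists p, [/\ S p, p <> 0, x * p = p & p * y = p].
  move=> xx yy x0 y0 Sx Sy; apply: contrapT => n.
  have [s Ss|//|//] := S_prime (x := x) (y := y); apply: contrapT => xsy.
  apply: n; exists (x * s * y); split => //; first by apply/Sy/Sx.
    by rewrite !mulrA xx.
  by rewrite -mulrA yy.
have Sf_l s : S s -> S (f * s) by exact: SM.
have Sf_r s : S s -> S (s * f) by move=> Ss; exact: SM.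
have [p12 [S12 p12_0 f12 p12g]] := ex _ _ ff gg f0 g0 Sf_l Sr.
have [p21 [S21 p21_0 g21 p21f]] := ex _ _ gg ff g0 f0 Sl Sf_r.
have [w [Sw w0 gw wg]] := ex _ _ gg gg g0 g0 Sl Sr.
have gE : g = 1 + f by [].
clearbody g.
have g12 : g * p12 = 0 by rewrite -f12 mulrA gf mul0r.
have f21 : f * p21 = 0 by rewrite -g21 mulrA fg mul0r.
have fw : f * w = 0 by rewrite -gw mulrA fg mul0r.
have p12f : p12 * f = 0 by rewrite -p12g -mulrA gf mulr0.
have p21g : p21 * g = 0 by rewrite -p21f -mulrA fg mulr0.
have wf : w * f = 0 by rewrite -wg -mulrA gf mulr0.
pose sum c1 c2 c3 c4 := c1 * f + c2 * p12 + c3 * p21 + c4 * w.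
have sumE c1 c2 c3 c4 x y : C c1 -> C c2 -> C c3 -> C c4 ->
    x * sum c1 c2 c3 c4 * y =
    c1 * (x * f * y) + c2 * (x * p12 * y) + c3 * (x * p21 * y) + c4 * (x * w * y).
  move=> Z1 Z2 Z3 Z4; rewrite /sum !mulrDr !mulrDl (centralCA _ _ Z1) (centralCA _ _ Z2).
  rewrite (centralCA _ _ Z3) (centralCA _ _ Z4).
  by rewrite -!mulrA.
(* Multiplying by f or g on each side isolates one coefficient. *)
have free c1 c2 c3 c4 : C c1 -> C c2 -> C c3 -> C c4 -> sum c1 c2 c3 c4 = 0 ->
    [/\ c1 = 0, c2 = 0, c3 = 0 & c4 = 0].
  move=> Z1 Z2 Z3 Z4 s0; have xy x y := sumE c1 c2 c3 c4 x y Z1 Z2 Z3 Z4.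
  have c0 c z : C c -> z <> 0 -> 0 = c * z -> c = 0.
    by move=> cZ z0 /esym/(scale_eq0 cZ)[].
  split.
  - apply: (c0 _ f) => //; have := xy f f.
    by rewrite s0 mulr0 mul0r ff f12 f21 fw ff p12f mul0r !mulr0 !addr0.
  - apply: (c0 _ p12) => //; have := xy f g.
    by rewrite s0 mulr0 mul0r ff f12 f21 fw fg p12g mul0r !mulr0 !addr0 add0r.
  - apply: (c0 _ p21) => //; have := xy g f.
    by rewrite s0 mulr0 mul0r gf g12 g21 gw p21f wf mul0r !mulr0 !addr0 !add0r.
  - apply: (c0 _ w) => //; have := xy g g.
    by rewrite s0 mulr0 mul0r gf g12 g21 gw p21g wg mul0r !mulr0 !add0r.
have span := S_spans Sf S12 S21 Sw free.
have gSg x : S x -> exists2 c, C c & g * x * g = c * w.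
  move=> /span[c1 [c2 [c3 [c4 [Z1 Z2 Z3 Z4 xE]]]]]; exists c4 => //.
  rewrite xE sumE// !(gf, g12, g21, gw) !mul0r p21g wg.
  by rewrite !mulr0 !add0r.
(* In the line g S g = C w, w^2 = c w with c nonzero, since otherwise w S w = 0. Then w / c is an
   identity of g S g and must be g. *)
have [c cZ ww] : exists2 c, C c & w * w = c * w.
  by have [c cZ cE] := gSg _ (SM Sw Sw); exists c; rewrite // -cE mulrA gw -mulrA wg.
have c0 : c <> 0.
  move=> c0; have [s Ss|//|//] := S_prime (x := w) (y := w).
  have [d dZ dE] := gSg _ Ss.
  have -> : w * s * w = w * (g * s * g) * w by rewrite !mulrA wg -!mulrA gw.
  by rewrite dE (centralCA _ _ dZ) ww c0 mul0r mulr0 mul0r.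
have [d dZ cd] := C_inv cZ c0.
have dw : d * w = g.
  apply: add_eq0_char2; have [s Ss|//|//] := S_prime (x := g) (y := d * w + g).
  have [b bZ bE] := gSg _ Ss.
  have -> : g * s * (d * w + g) = g * s * g * (d * w + g).
    by rewrite -[RHS]mulrA [g * (d * w + g)]mulrDr gg (centralCA _ _ dZ) gw.
  rewrite bE -mulrA mulrDr (centralCA _ _ dZ) ww wg [d * _]mulrA -[d * c]cZ cd mul1r.
  by rewrite char2 mulr0.
have wE : w = c * g by rewrite -dw mulrA cd mul1r.
split=> //; first by rewrite ff char2; apply: central0.
move=> s /span[c1 [c2 [c3 [c4 [Z1 Z2 Z3 Z4 sE]]]]] fs.
(* Commuting with f kills both mixed Peirce components, leaving c1 f + c4 w with w = c (1 + f). *)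
have c12 : c2 * p12 = 0.
  have : f * s * g = 0 by rewrite fs -mulrA fg mulr0.
  by rewrite sE sumE// !(ff, f12, f21, fw) !mul0r fg p12g !mulr0 !addr0 add0r.
have c21 : c3 * p21 = 0.
  have : g * s * f = 0 by rewrite -mulrA -fs mulrA gf mul0r.
  by rewrite sE sumE// !(gf, g12, g21, gw) !mul0r p21f wf !mulr0 !addr0 !add0r.
exists (c4 * c), (c1 + c4 * c); split.
- exact: centralM.
- by apply: centralD => //; apply: centralM.
- rewrite sE /sum c12 c21 !addr0 wE gE; char2_ring.
Qed.

Lemma noncentral_witness x : ~ C x -> exists2 z, S z & x * z <> z * x.
Proof.
move=> nCx; apply: contrapT => nz; apply: nCx; apply: S_central => s Ss.
by apply: contrapT => xs; apply: nz; exists s.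
Qed.

Lemma central_scale_inv c x : C c -> c <> 0 -> C (c * x) -> C x.
Proof.
move=> cZ c0 cxZ; have [d dZ cd] := C_inv cZ c0.
by rewrite -[x]mul1r -cd cZ -mulrA; apply: centralM.
Qed.

(* If [1, x, x^2, z] spans, then [x, S] is the line of [x, z], which therefore
   contains [x, [x, z]] = [x^2, z]. *)
Lemma quadratic x : S 1 -> S x -> exists2 l, C l & C (x * x + l * x).
Proof.
move=> S1 Sx; case: (EM (C x)) => [xZ|nxZ].
  by exists 0; [exact: central0 | rewrite mul0r addr0; exact: centralM].
apply: contrapT => nl; have [z Sz xz] := noncentral_witness nxZ.
have xz0 : x * z + z * x <> 0 by move=> /add_eq0_char2.
have xxZ c : C c -> x * (c * x) = c * x * x by move=> cZ; rewrite (centralCA _ _ cZ) mulrA.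
(* Bracketing with a y that commutes with x sees only the z-coordinate. *)
have brE c1 c2 c3 c4 y s : C c1 -> C c2 -> C c3 -> C c4 -> y * x = x * y ->
    s = c1 * 1 + c2 * x + c3 * (x * x) + c4 * z -> y * s + s * y = c4 * (y * z + z * y).
  move=> Z1 Z2 Z3 Z4 yx ->.
  rewrite !mulrDr mulr1 (centralCA _ _ Z2) (centralCA _ _ Z3) (centralCA _ _ Z4) -Z1.
  rewrite yx [y * (x * x)]mulrA yx -[x * y * x]mulrA yx; char2_ring.
have free c1 c2 c3 c4 : C c1 -> C c2 -> C c3 -> C c4 ->
    c1 * 1 + c2 * x + c3 * (x * x) + c4 * z = 0 ->
    [/\ c1 = 0, c2 = 0, c3 = 0 & c4 = 0].
  move=> Z1 Z2 Z3 Z4 s0; have := brE _ _ _ _ x _ Z1 Z2 Z3 Z4 erefl (esym s0).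
  rewrite mulr0 mul0r addr0 => /esym/(scale_eq0 Z4)[] // c4E.
  move: s0; rewrite c4E mul0r addr0 mulr1 => s0.
  have c3E : c3 = 0.
    apply: contrapT => c30; apply: nl; have [d dZ cd] := C_inv Z3 c30.
    exists (d * c2); first exact: centralM.
    apply: (central_scale_inv Z3 c30).
    have -> : c3 * (x * x + d * c2 * x) = c1; last by [].
    rewrite mulrDr !mulrA cd mul1r; apply: add_eq0_char2.
    by rewrite -s0; char2_ring.
  move: s0; rewrite c3E mul0r addr0 => s0.
  have c2E : c2 = 0.
    apply: contrapT => c20; apply/nxZ/(central_scale_inv Z2 c20).
    by rewrite -(add_eq0_char2 s0).
  by move: s0; rewrite c2E mul0r addr0.
have span := S_spans S1 Sx (SM Sx Sx) Sz free.
have Sxz : S (x * z + z * x) by apply: SD; apply: SM.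
have [c1 [c2 [c3 [c4 [Z1 Z2 Z3 Z4 xzE]]]]] := span _ Sxz.
(* [x, [x, z]] = c4 [x, z] says that x^2 + c4 x commutes with z, hence with everything in S. *)
have xxzE := brE _ _ _ _ x _ Z1 Z2 Z3 Z4 erefl xzE.
have yz : (x * x + c4 * x) * z + z * (x * x + c4 * x) = 0.
  rewrite (_ : _ + _ = x * (x * z + z * x) + (x * z + z * x) * x + c4 * (x * z + z * x)).
    by rewrite xxzE char2.
  by rewrite [z * (_ + _)]mulrDr (centralCA _ _ Z4); char2_ring.
apply: nl; exists c4 => //; apply: S_central => s /span[d1 [d2 [d3 [d4 [? ? ? ? sE]]]]].
have yx : (x * x + c4 * x) * x = x * (x * x + c4 * x).
  by rewrite mulrDl mulrDr mulrA xxZ.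
by apply: add_eq0_char2; rewrite (brE d1 d2 d3 d4 _ s)// yz mulr0.
Qed.

Lemma ex_separable : S 1 -> (exists x z, [/\ S x, S z & x * z <> z * x]) ->
  exists e, [/\ S e, ~ C e & C (e * e + e)].
Proof.
move=> S1 [x [z [Sx Sz xz]]].
have [[e [l [Se lZ l0 eZ elZ]]]|ninsep] :=
    EM (exists e l, [/\ S e, C l, l <> 0, ~ C e & C (e * e + l * e)]).
  (* With d = 1/l, (d e)^2 + d e = d^2 (e^2 + l e). *)
  have [d dZ ld] := C_inv lZ l0; exists (d * e); split; first exact: SZ.
    by move=> /(central_scale_inv dZ) de; apply/eZ/de => d0; apply: l0;
      rewrite -[l]mulr1 -ld d0 !mulr0.
  have -> : d * e * (d * e) + d * e = d * d * (e * e + l * e).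
    rewrite mulrDr; congr (_ + _); first by rewrite -!mulrA (centralCA _ _ dZ).
    by rewrite !mulrA -[d * d * l]mulrA -[d * l]lZ ld mulr1.
  by apply: centralM => //; apply: centralM.
have sqZ y : S y -> C (y * y).
  move=> Sy; case: (EM (C y)) => [yZ|nyZ]; first exact: centralM.
  have [l lZ ylZ] := quadratic S1 Sy; case: (EM (l = 0)) => [l0|l0].
    by move: ylZ; rewrite l0 mul0r addr0.
  by case: ninsep; exists y, l.
have brZ u v : S u -> S v -> C (u * v + v * u).
  move=> Su Sv; rewrite (_ : _ + _ = (u + v) * (u + v) + (u * u + v * v)).
    by apply: centralD; [exact/sqZ/SD | apply: centralD; apply: sqZ].
  char2_ring.
suff xZ : C x by case: xz; apply: xZ.
apply: (central_scale_inv (brZ _ _ Sx Sz)); first by move=> /add_eq0_char2.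
rewrite brZ// (_ : _ * _ = x * (x * z) + x * z * x); first by apply: brZ => //; apply: SM.
by rewrite mulrDr !mulrA.
Qed.

(* Were the centralizer of [e] larger, [e, S] would be a line [C v] with
   [v S v = 0]. *)
Lemma separable_centralizer e : S 1 -> S e -> ~ C e -> C (e * e + e) -> separable_frame e.
Proof.
move=> S1 Se neZ eeZ; split => // k Sk ek; apply: contrapT => nk.
have [z Sz ez] := noncentral_witness neZ.
have ez0 : e * z + z * e <> 0 by move=> /add_eq0_char2.
have brE c1 c2 c3 c4 s : C c1 -> C c2 -> C c3 -> C c4 ->
    s = c1 * 1 + c2 * e + c3 * k + c4 * z -> e * s + s * e = c4 * (e * z + z * e).
  move=> Z1 Z2 Z3 Z4 ->.
  rewrite !mulrDr mulr1 (centralCA _ _ Z2) (centralCA _ _ Z3) (centralCA _ _ Z4) -Z1 ek.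
  char2_ring.
have free c1 c2 c3 c4 : C c1 -> C c2 -> C c3 -> C c4 ->
    c1 * 1 + c2 * e + c3 * k + c4 * z = 0 ->
    [/\ c1 = 0, c2 = 0, c3 = 0 & c4 = 0].
  move=> Z1 Z2 Z3 Z4 s0; have := brE _ _ _ _ _ Z1 Z2 Z3 Z4 (esym s0).
  rewrite mulr0 mul0r addr0 => /esym/(scale_eq0 Z4)[] // c4E.
  move: s0; rewrite c4E mul0r addr0 mulr1 => s0.
  have c3E : c3 = 0.
    apply: contrapT => c30; apply: nk; have [d dZ cd] := C_inv Z3 c30.
    exists (d * c1), (d * c2); split; try exact: centralM.
    by rewrite -[k]mul1r -cd Z3 -mulrA -(add_eq0_char2 s0) mulrDr mulrA.
  move: s0; rewrite c3E mul0r addr0 => s0.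
  have c2E : c2 = 0.
    apply: contrapT => c20; apply/neZ/(central_scale_inv Z2 c20).
    by rewrite -(add_eq0_char2 s0).
  by move: s0; rewrite c2E mul0r addr0.
have span := S_spans S1 Se Sk Sz free.
pose v := e * z + z * e.
have Sv : S v by apply: SD; apply: SM.
have eS s : S s -> exists2 c, C c & e * s + s * e = c * v.
  move=> /span[c1 [c2 [c3 [c4 [Z1 Z2 Z3 Z4 sE]]]]]; exists c4 => //.
  exact: brE sE.
have ev : e * v + v * e = v.
  have := eeZ z; rewrite mulrDl mulrDr => h; apply: add_eq0_char2.
  rewrite (_ : _ + v = e * e * z + e * z + (z * (e * e) + z * e)).
    by rewrite h char2.
  by rewrite /v; char2_ring.
(* e v = [e, e z] lies in the line [e, S]. *)
have [l lZ evl] : exists2 l, C l & e * v = l * v.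
  by have [l lZ lE] := eS _ (SM Se Sz); exists l; rewrite // -lE mulrDr !mulrA.
have ve : v * e = l * v + v by rewrite -{3}ev evl addKr_self.
(* As v e = (l + 1) v, the two readings of v e v give l v^2 = (l + 1) v^2. *)
have vv : v * v = 0.
  have h : l * (v * v) = l * (v * v) + v * v.
    by rewrite -{1}(centralCA _ _ lZ) -evl mulrA ve mulrDl -mulrA.
  by apply: (addrI (l * (v * v))); rewrite addr0 -h.
case: ez0; have [s Ss|//|//] := S_prime (x := v) (y := v).
(* Write s = k' + c v with k' commuting with e; then v k' = [e, z k'] lies in C v, and v s v reduces
   to multiples of v^2. *)
have [c cZ cE] := eS _ Ss; pose k' := s + c * v.
have Sk' : S k' by apply: SD => //; apply: SZ.
have ek' : e * k' = k' * e.
  apply: add_eq0_char2; rewrite mulrDr mulrDl (centralCA _ _ cZ) -[c * v * e]mulrA.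
  by rewrite addrACA cE -mulrDr ev char2.
have [c' c'Z c'E] := eS _ (SM Sz Sk').
have vk' : v * k' = c' * v by rewrite -c'E mulrDl -!mulrA ek'.
have sE : s = k' + c * v by rewrite addrK_self.
rewrite sE [v * _]mulrDr vk' (centralCA _ _ cZ) vv mulr0 addr0 -mulrA vv.
exact: mulr0.
Qed.

Lemma ex_separable_frame : (exists x z, [/\ S x, S z & x * z <> z * x]) ->
  (exists f, [/\ S f, f <> 0 & f * f = f]) -> exists e, separable_frame e.
Proof.
move=> nc [f [Sf f0 ff]]; case: (EM (f = 1)) => [f1|f1]; last first.
  by exists f; apply: idempotent_frame.
have S1 : S 1 by rewrite -f1.
have [e [Se neZ eeZ]] := ex_separable S1 nc.
by exists e; apply: separable_centralizer.
Qed.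

(** * Structure of S relative to a frame *)

Section Frame.
Context (e : Q).
Hypothesis e_frame : separable_frame e.
Hypothesis S_noncomm : exists x z, [/\ S x, S z & x * z <> z * x].

(** This is V, the image of the idempotent map ad e written as its eigenspace for 1. When e is a
    diagonal matrix unit it consists of the off-diagonal matrices. *)
Definition off_diag : set Q := [set v | S v /\ e * v + v * e = v].

(** The kernel of the reduced trace, which contains the scalars in characteristic 2. *)
Definition trace0 : set Q := [set x | exists c v, [/\ C c, off_diag v & x = c + v]].

Let Se : S e. Proof. by case: e_frame. Qed.

Let eeE y : e * e * y + e * y = y * (e * e) + y * e.
Proof. by case: e_frame => _ eeZ _; rewrite -mulrDl -mulrDr. Qed.

Lemma off_diagE v : off_diag v -> e * v = v * e + v.
Proof. by move=> [_ ev]; rewrite -{3}ev [e * v + _]addrC addKr_self. Qed.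

Lemma off_diagD v w : off_diag v -> off_diag w -> off_diag (v + w).
Proof.
by move=> [Sv ev] [Sw ew]; split; [exact: SD | rewrite mulrDr mulrDl addrACA ev ew].
Qed.

Lemma off_diagZ c v : C c -> off_diag v -> off_diag (c * v).
Proof.
move=> cZ [Sv ev]; split; first exact: SZ.
by rewrite (centralCA _ _ cZ) -[c * v * e]mulrA -mulrDr ev.
Qed.

Lemma off_diag_br s : S s -> off_diag (e * s + s * e).
Proof.
move=> Ss; split; first by apply: SD; apply: SM.
apply: add_eq0_char2.
transitivity (e * e * s + e * s + (s * (e * e) + s * e)); first by char2_ring.
by rewrite eeE char2.
Qed.

(** Since ad e is idempotent, s + [e, s] commutes with e and so lies in C + Ce. *)
Lemma frame_decomp s : S s ->
  exists a b v, [/\ C a, C b, off_diag v & s = a + b * e + v].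
Proof.
move=> Ss; have ov := off_diag_br Ss; have [Sv ev] := ov.
have [_ _ /(_ (s + (e * s + s * e)))[]] := e_frame; first exact: SD.
  apply: add_eq0_char2; rewrite mulrDr mulrDl addrACA ev; exact: char2.
move=> a [b [aZ bZ sE]]; exists a, b, (e * s + s * e); split => //.
by rewrite -sE addrK_self.
Qed.

(** Moving e past an element of V turns it into e + 1; past two of them, back into e. *)
Lemma off_diag_mul v w : off_diag v -> off_diag w ->
  exists a b, [/\ C a, C b & v * w = a + b * e].
Proof.
move=> ov ow; have [_ _] := e_frame; apply; first by apply: SM; [case: ov | case: ow].
by rewrite mulrA (off_diagE ov) mulrDl -mulrA (off_diagE ow) mulrDr mulrA addrK_self.
Qed.

(** v^2 = a + b e commutes with v whereas [e, v] = v, so b v = 0. *)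
Lemma off_diag_sqr v : off_diag v -> C (v * v).
Proof.
move=> ov; have [a [b [aZ bZ vvE]]] := off_diag_mul ov ov.
have : b * v = 0.
  have := mulrA v v v; rewrite vvE mulrDl mulrDr -aZ (centralCA _ _ bZ) -[b * e * v]mulrA.
  by rewrite (off_diagE ov) mulrDr addrA => /esym h; apply: (addrI (a * v + b * (v * e)));
    rewrite addr0.
case/(scale_eq0 bZ) => [b0|->]; last by rewrite mulr0; apply: central0.
by rewrite vvE b0 mul0r addr0.
Qed.

Lemma off_diag_form v w : off_diag v -> off_diag w -> C (v * w + w * v).
Proof.
move=> ov ow; rewrite (_ : _ + _ = (v + w) * (v + w) + (v * v + w * w)); last by char2_ring.
apply: centralD; first exact/off_diag_sqr/off_diagD.
by apply: centralD; apply: off_diag_sqr.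
Qed.

(** V is stable under right multiplication by any k commuting with e. If v commuted with V, it would
    commute with v k: k = e gives v^2 = 0, and then v k v and v w v vanish for w in V, so that v S v
    = 0. *)
Lemma off_diag_nondeg v : off_diag v -> v <> 0 ->
  exists2 w, off_diag w & v * w + w * v <> 0.
Proof.
move=> ov v0; apply: contrapT => nw.
have cv w : off_diag w -> v * w = w * v.
  by move=> ow; apply: add_eq0_char2; apply: contrapT => vw; apply: nw; exists w.
have Sv : S v by case: ov.
have offr k : S k -> e * k = k * e -> off_diag (v * k).
  move=> Sk ek; split; first exact: SM.
  by rewrite mulrA (off_diagE ov) mulrDl -!mulrA ek addrAC char2 add0r.
have vv : v * v = 0.
  have ve := cv _ (offr _ Se erefl).
  by apply: (addrI (v * e * v)); rewrite addr0 -{1}ve -mulrDr -(off_diagE ov) mulrA.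
have [s Ss|//|//] := S_prime (x := v) (y := v).
have ow := off_diag_br Ss; pose k := s + (e * s + s * e).
have Sk : S k by apply: SD => //; case: ow.
have ek : e * k = k * e.
  by apply: add_eq0_char2; rewrite mulrDr mulrDl addrACA; case: ow => _ ->; apply: char2.
have sE : s = k + (e * s + s * e) by rewrite addrK_self.
rewrite sE mulrDr mulrDl -(cv _ (offr _ Sk ek)) mulrA vv mul0r add0r.
by rewrite -mulrA -(cv _ ow) mulrA vv mul0r.
Qed.

(** The coefficients are given by Cramer's rule for the alternating form. The remainder z commutes
    with v and w, hence with v w = p + q e, so that q z = q [e, z] = 0. *)
Lemma off_diag_span v w u : off_diag v -> off_diag w -> off_diag u ->
  v * w + w * v <> 0 -> exists a b, [/\ C a, C b & u = a * v + b * w].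
Proof.
move=> ov ow ou vw0; have gZ := off_diag_form ov ow.
have [d dZ gd] := C_inv gZ vw0.
set g := v * w + w * v in gZ vw0 gd.
pose a := d * (u * w + w * u); pose b := d * (u * v + v * u).
have aZ : C a by apply: centralM => //; apply: off_diag_form.
have bZ : C b by apply: centralM => //; apply: off_diag_form.
exists a, b; split => //; apply: add_eq0_char2; set z := u + _.
have oz : off_diag z by do 2?apply: off_diagD => //; apply: off_diagZ.
have br_lin x : z * x + x * z = u * x + x * u + (a * (v * x + x * v) + b * (w * x + x * w)).
  by rewrite /z !mulrDr (centralCA _ _ aZ) (centralCA _ _ bZ); char2_ring.
clearbody z.
have scale_g x : d * x * g = x by rewrite [d * x]dZ -mulrA [d * g]dZ gd mulr1.
have zv : z * v = v * z.
  by apply: add_eq0_char2; rewrite br_lin char2 mulr0 add0r [w * v + _]addrC scale_g char2.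
have zw : z * w = w * z.
  by apply: add_eq0_char2; rewrite br_lin char2 mulr0 addr0 scale_g char2.
have [p [q [pZ qZ vwE]]] := off_diag_mul ov ow.
(* Otherwise v w is central and g v = 0, which forces v = 0 and then g = 0. *)
have q0 : q <> 0.
  move=> q0; apply: vw0; have vwZ : C (v * w) by rewrite vwE q0 mul0r addr0.
  have : g * v = 0 by rewrite gZ mulrDr -[v * (v * w)]vwZ mulrA char2.
  by case/(scale_eq0 gZ) => // v0; rewrite /g v0 mul0r mulr0 addr0.
have h : z * (v * w) = v * w * z by rewrite mulrA zv -mulrA zw mulrA.
rewrite vwE mulrDr mulrDl -pZ (centralCA _ _ qZ) -[q * e * z]mulrA in h.
have : q * (e * z + z * e) = 0 by rewrite mulrDr -(addrI _ h) char2.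
by case: oz => _ -> /(scale_eq0 qZ)[].
Qed.

Lemma off_diag_neq0 : exists2 v, off_diag v & v <> 0.
Proof.
apply: contrapT => nv; have [x [z [Sx Sz xz]]] := S_noncomm; apply: xz.
have Ke s : S s -> exists a b, [/\ C a, C b & s = a + b * e].
  move=> /frame_decomp[a [b [v [aZ bZ ov ->]]]]; exists a, b; split => //.
  have -> : v = 0 by apply: contrapT => v0; apply: nv; exists v.
  by rewrite addr0.
have [a [b [aZ bZ ->]]] := Ke _ Sx; have [c [d [cZ dZ ->]]] := Ke _ Sz.
have cab y : C y -> (a + b * e) * y = y * (a + b * e) by move=> ->.
have ebe : (a + b * e) * e = e * (a + b * e).
  by rewrite mulrDl mulrDr aZ (centralCA _ _ bZ) mulrA.
by rewrite mulrDr [RHS]mulrDl cab// (centralCA _ _ dZ) ebe mulrA.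
Qed.

Lemma trace0_off v : off_diag v -> trace0 v.
Proof. by move=> ov; exists 0, v; rewrite add0r; split => //; apply: central0. Qed.

Lemma brC x y : x * y + y * x = y * x + x * y. Proof. exact: addrC. Qed.

Lemma brDr x y z : x * (y + z) + (y + z) * x = (x * y + y * x) + (x * z + z * x).
Proof. by rewrite mulrDr mulrDl addrACA. Qed.

Lemma brZr c x y : C c -> x * (c * y) + c * y * x = c * (x * y + y * x).
Proof. by move=> cZ; rewrite (centralCA _ _ cZ) -mulrA mulrDr. Qed.

Lemma br_central c x : C c -> x * c + c * x = 0.
Proof. by move=> ->; exact: char2. Qed.

Lemma trace0_br x y : trace0 x -> trace0 y -> C (x * y + y * x).
Proof.
move=> [a [v [aZ ov ->]]] [b [w [bZ ow ->]]].
rewrite brDr (br_central _ bZ) add0r brC brDr (br_central _ aZ) add0r.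
exact: off_diag_form.
Qed.

(** Modulo scalars, a + b e + v acts on V by its e-coordinate b. *)
Lemma br_frame a b v w : C a -> C b -> off_diag v -> off_diag w ->
  (a + b * e + v) * w + w * (a + b * e + v) = b * w + (v * w + w * v).
Proof.
move=> aZ bZ ov [_ ow]; rewrite brC 2!brDr (br_central _ aZ) add0r (brZr _ _ bZ).
by rewrite [w * e + _]brC ow [w * v + _]brC.
Qed.

(** The e-coordinates cancel: the bracket of a + b e + v and c + d e + w is [v, w] + d v + b w. *)
Lemma br_trace0 x y : S x -> S y -> trace0 (x * y + y * x).
Proof.
move=> /frame_decomp[a [b [v [aZ bZ ov ->]]]] /frame_decomp[c [d [w [cZ dZ ow ->]]]].
exists (v * w + w * v), (d * v + b * w); split; first exact: off_diag_form.
  by apply: off_diagD; apply: off_diagZ.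
rewrite [in LHS]brDr (br_frame aZ bZ ov ow) brDr (br_central _ cZ) add0r.
rewrite (brZr _ _ dZ) [_ * e + _]brC.
rewrite 2!brDr (br_central _ aZ) add0r (brZr _ _ bZ) char2 mulr0 add0r.
by case: ov => _ ->; rewrite [RHS]addrC addrA.
Qed.

(** * Subspaces stable under bracketing with V, to be applied to LC and AC *)

Section LieSubspace.
Context (N : set Q).
Hypothesis NS : N `<=` S.
Hypothesis ND : forall x y, N x -> N y -> N (x + y).
Hypothesis NZ : forall c x, C c -> N x -> N (c * x).
Hypothesis N_off : forall x v, N x -> off_diag v -> N (x * v + v * x).

Let N_central g c : N g -> C g -> g <> 0 -> C c -> N c.
Proof.
move=> Ng gZ g0 cZ; have [d dZ gd] := C_inv gZ g0.
have -> : c = c * d * g by rewrite -mulrA dZ gd mulr1.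
by apply: NZ => //; apply: centralM.
Qed.

(** An n in N outside C + V has e-coordinate b nonzero, and [n, w] is b w up to a scalar. A second
    bracket removes that scalar: [[n, p], q] = b [p, q] is nonzero for suitable p, q, so N contains
    C and then every w. *)
Lemma lie_sub_trace0 : ~ (N `<=` trace0) -> trace0 `<=` N.
Proof.
move=> /existsNP[n /not_implyP[Nn nT]].
have [b [v [bZ b0 ov nE]]] : exists b v, [/\ C b, b <> 0, off_diag v &
    forall w, off_diag w -> N (b * w + (v * w + w * v))].
  have [a [b [v [aZ bZ ov nE]]]] := frame_decomp (NS Nn); exists b, v; split => //.
    by move=> b0; apply: nT; exists a, v; split; rewrite // nE b0 mul0r addr0.
  by move=> w ow; rewrite -(br_frame aZ)// -nE; apply: N_off.
have [p op p0] := off_diag_neq0; have [q oq pq0] := off_diag_nondeg op p0.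
have gZ := off_diag_form op oq.
have Ng : N (b * (p * q + q * p)).
  have := N_off (nE _ op) oq; rewrite brC brDr (brZr _ _ bZ) brC.
  by rewrite (br_central _ (off_diag_form ov op)) addr0.
have CN c : C c -> N c.
  apply: (N_central Ng); first exact: centralM.
  by case/(scale_eq0 bZ).
move=> _ [c [w [cZ ow ->]]]; apply: ND; first exact: CN.
have [d dZ bd] := C_inv bZ b0.
have -> : w = d * (b * w + (v * w + w * v) + (v * w + w * v)).
  by rewrite addrK_self mulrA dZ bd mul1r.
by apply: NZ => //; apply: ND; [exact: nE | apply/CN/off_diag_form].
Qed.

(** The bracket of a = al + v with a w not orthogonal to v is a nonzero scalar, so N contains C and
    v. An element of N outside Cv + C would bring in the whole plane V. *)
Lemma lie_sub_trace0_plane a : N a -> ~ C a -> N `<=` trace0 -> ~ (trace0 `<=` N) ->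
  C (a * a) /\ N = [set c * a + c' | c in C & c' in C].
Proof.
move=> Na aZ NT TN; have [al [v [alZ ov aE]]] := NT _ Na.
have v0 : v <> 0 by move=> v0; apply: aZ; rewrite aE v0 addr0.
have [w ow vw0] := off_diag_nondeg ov v0.
have gZ := off_diag_form ov ow.
have CN c : C c -> N c.
  apply: (N_central _ gZ vw0); have := N_off Na ow.
  by rewrite aE brC brDr (br_central _ alZ) add0r brC.
have vE : v = a + al by rewrite aE addrC addKr_self.
have Nv : N v by rewrite vE; apply: ND => //; apply: CN.
split.
  rewrite (_ : a * a = al * al + v * v).
    by apply: centralD; [exact: centralM | exact: off_diag_sqr].
  by rewrite aE !mulrDr !mulrDl -(alZ v); char2_ring.
apply/seteqP; split=> [x Nx|_ [c cZ [c' c'Z <-]]]; last first.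
  by apply: ND; [exact: NZ | exact: CN].
have [be [u [beZ ou xE]]] := NT _ Nx.
have [p [q [pZ qZ uE]]] := off_diag_span ov ow ou vw0.
have q0 : q = 0.
  apply: contrapT => q0; apply: TN => _ [c [t [cZ ot ->]]].
  apply: ND; first exact: CN.
  have [r [s [rZ sZ ->]]] := off_diag_span ov ow ot vw0.
  have [d dZ qd] := C_inv qZ q0.
  apply: ND; first exact: NZ.
  apply: NZ => //; have -> : w = d * (x + be + p * v).
    by rewrite xE uE addrC [be + _]addrC addrK_self addKr_self mulrA dZ qd mul1r.
  by do 2?[apply: NZ => //]; apply: ND; [apply: ND => //; exact: CN | exact: NZ].
exists p => //; exists (p * al + be); first by apply: centralD => //; apply: centralM.
by rewrite xE uE q0 mul0r addr0 vE mulrDr addrA [RHS]addrC.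
Qed.

(** In the remaining case N = Cx + C, which is commutative. *)
Lemma lie_nonabelian_trace0 x y : N x -> N y -> x * y + y * x <> 0 -> trace0 `<=` N.
Proof.
move=> Nx Ny xy0; apply: contrapT => TN.
have NT : N `<=` trace0 by apply: contrapT => /lie_sub_trace0.
have xZ : ~ C x by move=> xZ; apply: xy0; rewrite brC br_central.
have [_ NE] := lie_sub_trace0_plane Nx xZ NT TN.
move: Ny; rewrite NE => -[c cZ [c' c'Z yE]]; apply: xy0.
by rewrite -yE brDr (br_central _ c'Z) addr0 (brZr _ _ cZ) char2 mulr0.
Qed.
End LieSubspace.
End Frame.
End QuaternionChar2.

(** * Exceptional prime rings *)

Section ExceptionalRing.
Context (R : primeRngType).
Hypothesis excR : exceptional R.
Implicit Types (A B L : set R) (a r u : R) (x y w : Qs R).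
Local Notation C := (ext_centroid R).
Local Notation RC := (scalC [set: R]).

Let char2Q x : x + x = 0. Proof. by apply: Qs_char2; case: excR. Qed.

Let RCD x y : RC x -> RC y -> RC (x + y). Proof. exact: scalCD. Qed.

Lemma rcommE x y : rcomm x y = x * y + y * x.
Proof. by congr (_ + _); apply: (addrI (y * x)); rewrite char2Q subrr. Qed.

Lemma Qemb_rcomm a b : Qemb (rcomm a b) = Qemb a * Qemb b + Qemb b * Qemb a.
Proof. by rewrite -rcommE /rcomm QembB !QembM. Qed.

Lemma scalC_sub A : scalC A `<=` RC.
Proof.
apply: scalC_ind; first exact: scalC_subgroup.
  by move=> c x; apply: scalCZ.
by move=> a _; apply: scalC_emb.
Qed.

(** Bilinear extension, which turns [A, L] in A into [AC, LC] in AC. *)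
Lemma br_ind A B (P : set (Qs R)) :
  add_subgroup P -> (forall c x, C c -> P x -> P (c * x)) ->
  (forall a b, A a -> B b -> P (Qemb (rcomm a b))) ->
  forall x y, scalC A x -> scalC B y -> P (x * y + y * x).
Proof.
move=> sP PZ PAB x y Ax By; move: x Ax; apply: scalC_ind.
- split=> [|x1 x2] /=; first by rewrite mul0r mulr0 addr0; apply: sP.1.
  by move=> P1 P2; rewrite mulrBl mulrBr addrACA -opprD; apply: sP.2.
- by move=> c x cZ Px; rewrite -mulrA (centralCA _ _ cZ) -mulrDr; apply: PZ.
move=> a Aa; move: y By; apply: scalC_ind.
- split=> [|x1 x2] /=; first by rewrite mul0r mulr0 addr0; apply: sP.1.
  by move=> P1 P2; rewrite mulrBl mulrBr addrACA -opprD; apply: sP.2.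
- by move=> c x cZ Px; rewrite -mulrA (centralCA _ _ cZ) -mulrDr; apply: PZ.
by move=> b Bb; rewrite -Qemb_rcomm; apply: PAB.
Qed.

Lemma nonabelian_witness L : nonabelian L ->
  exists u v, [/\ L u, L v & rcomm u v <> 0].
Proof.
move=> Lna; apply: contrapT => nuv; apply: Lna.
apply/seteqP; split=> [|x ->]; last exact: (add_subgroup_smallest _).1.
apply: smallest_sub; first by split=> // x y -> ->; rewrite subrr.
move=> _ [u Lu [v Lv <-]]; apply: contrapT => uv0.
by apply: nuv; exists u, v.
Qed.

Lemma commset_gen A B a b : A a -> B b -> commset A B (rcomm a b).
Proof. by move=> Aa Bb; apply: sub_gen_smallest; exists a => //; exists b. Qed.

Lemma rcomm_center r u z : rcenter R z -> rcomm u (r ** z) = rcomm u r ** z.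
Proof. by move=> zZ; rewrite /rcomm rmulBr -!rmulA (zZ u) !rmulA. Qed.

(** * The action of the Lie ideal on A *)

Section LieIdealAction.
Context (A L : set R) (e : Qs R).
Hypothesis A_noncentral : ~ (A `<=` rcenter R).
Hypothesis L_lie : lie_ideal L.
Hypothesis L_nonabelian : nonabelian L.
Hypothesis AL_sub : commset A L `<=` A.
Hypothesis e_frame : separable_frame RC e.
Local Notation off := (off_diag RC e).
Local Notation T := (trace0 RC e).

Let RC_noncomm : exists x z, [/\ RC x, RC z & x * z <> z * x].
Proof.
have [u [v [Lu Lv uv0]]] := nonabelian_witness L_nonabelian.
exists (Qemb u), (Qemb v); split; try exact: scalC_emb.
by move=> uv; apply/uv0/Qemb_eq0; rewrite Qemb_rcomm uv char2Q.
Qed.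

Let offRC w : off w -> RC w. Proof. by case. Qed.

(** LC is stable under bracketing with RC and is not commutative. *)
Let T_sub_LC : T `<=` scalC L.
Proof.
have [u [v [Lu Lv uv0]]] := nonabelian_witness L_nonabelian.
apply: (lie_nonabelian_trace0 char2Q ext_centroid_inv RCD (@scalCZ R setT) RC_mul
  RC_prime e_frame RC_noncomm (scalC_sub (A := L)) (@scalCD R L) (@scalCZ R L)
  _ (scalC_emb Lu) (scalC_emb Lv)).
- move=> x w Lx /offRC RCw; apply: br_ind Lx RCw.
  + exact: scalC_subgroup.
  + by move=> c y; apply: scalCZ.
  + by move=> a r La _; apply: scalC_emb; apply: L_lie.2; apply: commset_gen.
- by rewrite -Qemb_rcomm => /Qemb_eq0.
Qed.

(** V lies in LC, and [AC, LC] lies in AC. *)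
Let AC_off x w : scalC A x -> off w -> scalC A (x * w + w * x).
Proof.
move=> Ax /trace0_off/T_sub_LC Lw; apply: br_ind Ax Lw.
- exact: scalC_subgroup.
- by move=> c y; apply: scalCZ.
- by move=> a u Aa Lu; apply: scalC_emb; apply: AL_sub; apply: commset_gen.
Qed.

Let comm_LR u r : L u -> L (rcomm u r).
Proof. by move=> Lu; apply: L_lie.2; apply: commset_gen. Qed.

Let comm_AL a u : A a -> L u -> A (rcomm a u).
Proof. by move=> Aa Lu; apply: AL_sub; apply: commset_gen. Qed.

(* [C [L, R]] contains [w = [w, e]] for every off-diagonal [w]. *)
Lemma off_diag_ind (P : set (Qs R)) :
  add_subgroup P -> (forall c x, C c -> P x -> P (c * x)) ->
  (forall u r, L u -> P (Qemb (rcomm u r))) -> off `<=` P.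
Proof.
move=> sP PZ PL w ow; have [_ <-] := ow; rewrite addrC.
apply: (br_ind (A := L) (B := setT) sP PZ); first by move=> u r Lu _; apply: PL.
  by apply: T_sub_LC; apply: trace0_off.
by case: e_frame.
Qed.

(** The preimage of a C-subspace under ad t is a C-subspace, as [off_diag_ind] requires. *)
Let br_pre (t : Qs R) (Z : set (Qs R)) : add_subgroup Z ->
  (forall c x, C c -> Z x -> Z (c * x)) ->
  add_subgroup [set x | Z (t * x + x * t)] /\
  (forall c x, C c -> Z (t * x + x * t) -> Z (t * (c * x) + c * x * t)).
Proof.
move=> sZ ZZ; split.
  split=> [|x y Zx Zy] /=; first by rewrite mul0r mulr0 addr0; apply: sZ.1.
  by rewrite mulrBl mulrBr addrACA -opprD; apply: sZ.2.
by move=> c x cZ Zx; rewrite (centralCA _ _ cZ) -mulrA -mulrDr; apply: ZZ.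
Qed.

(** For t in A outside C + V, the elements [t, [u, r]] lie in A and have trace 0. If all were
    central, [t, V] would be too; but [t, w] is b w up to a scalar, with b nonzero, so w would be
    central and w = [e, w] = 0. *)
Lemma ex_noncentral_trace0 : exists a, [/\ A a, ~ rcenter R a & T (Qemb a)].
Proof.
have [[t [At tT]]|AT] := EM (exists t, A t /\ ~ T (Qemb t)); last first.
  have /existsNP[a /not_implyP[Aa aZ]] := A_noncentral; exists a; split => //.
  by apply: contrapT => aT; apply: AT; exists a.
have [[u [r [Lu nC]]]|nur] :=
    EM (exists u r, L u /\ ~ C (Qemb (rcomm t (rcomm u r)))).
  exists (rcomm t (rcomm u r)); split.
  - by apply: comm_AL => //; apply: comm_LR.
  - by move=> /rcenter_Qemb.
  - rewrite Qemb_rcomm; apply: (br_trace0 char2Q ext_centroid_inv RCD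
      (@scalCZ R setT) RC_mul e_frame); exact: scalC_emb.
have C_sub : add_subgroup C.
  split; first exact: ext_centroid0.
  by move=> x y xZ yZ; apply: ext_centroidD => //; apply: ext_centroidN.
have [tC_sub tC_Z] := br_pre (Qemb t) C_sub (@ext_centroidM R).
have tC : off `<=` [set x | C (Qemb t * x + x * Qemb t)].
  apply: off_diag_ind => // u r Lu /=; rewrite -Qemb_rcomm.
  by apply: contrapT => nC; apply: nur; exists u, r.
have [a [b [v [aZ bZ ov tE]]]] :=
  frame_decomp char2Q RCD RC_mul e_frame (scalC_emb (A := setT) (a := t) I).
have b0 : b <> 0.
  by move=> b0; apply: tT; exists a, v; split; rewrite // tE b0 mul0r addr0.
have [w ow w0] := off_diag_neq0 char2Q RCD RC_mul e_frame RC_noncomm.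
have bwZ : C (b * w).
  rewrite -[b * w](addrK_self char2Q (v * w + w * v)).
  rewrite -(br_frame char2Q aZ bZ ov ow) -tE.
  apply: ext_centroidD; first exact: tC.
  exact: (off_diag_form char2Q ext_centroid_inv RCD RC_mul e_frame).
have wZ : C w by apply: (central_scale_inv ext_centroid_inv bZ b0 bwZ).
by case: w0; case: ow => _ <-; apply: (br_central char2Q _ wZ).
Qed.

(** Elements of C + V have central brackets. If all [a, [u, r]] vanished, the V-part of a would be
    orthogonal to V, hence zero, and a central. *)
Lemma ex_central_commutator : exists a u r,
  [/\ A a, L u, rcenter R (rcomm a (rcomm u r)) & rcomm a (rcomm u r) <> 0].
Proof.
have [a [Aa aZ aT]] := ex_noncentral_trace0.
have [[u [r [Lu ur0]]]|nur] := EM (exists u r, L u /\ rcomm a (rcomm u r) <> 0).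
  exists a, u, r; split => //; apply/rcenter_Qemb; rewrite Qemb_rcomm.
  apply: (trace0_br char2Q ext_centroid_inv RCD RC_mul e_frame) => //.
  rewrite Qemb_rcomm; apply: (br_trace0 char2Q ext_centroid_inv RCD
    (@scalCZ R setT) RC_mul e_frame); exact: scalC_emb.
have zero_sub : add_subgroup [set 0 : Qs R].
  by split=> // x y -> ->; rewrite subrr.
have zero_Z (c x : Qs R) : C c -> [set 0] x -> [set 0] (c * x).
  by move=> _ ->; rewrite mulr0.
have [a0_sub a0_Z] := br_pre (Qemb a) zero_sub zero_Z.
have a0 : off `<=` [set x | Qemb a * x + x * Qemb a = 0].
  apply: off_diag_ind => // u r Lu /=; rewrite -Qemb_rcomm.
  suff -> : rcomm a (rcomm u r) = 0 by [].
  by apply: contrapT => ur0; apply: nur; exists u, r.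
have [c [v [cZ ov aE]]] := aT.
have v0 : v <> 0.
  by move=> v0; apply/aZ/rcenter_Qemb; rewrite aE v0 addr0.
have [w ow vw0] := off_diag_nondeg char2Q RCD RC_mul RC_prime e_frame ov v0.
case: vw0; have := a0 _ ow; rewrite /= aE addrC brDr (br_central char2Q _ cZ) add0r.
by rewrite addrC.
Qed.

Lemma ex_center_multiples : exists beta : R, [/\ rcenter R beta, beta <> 0 &
  [set beta ** z | z in rcenter R] `<=` A].
Proof.
have [a [u [r [Aa Lu bZ b0]]]] := ex_central_commutator.
exists (rcomm a (rcomm u r)); split => // _ [z zZ <-].
rewrite -(rcomm_center _ _ zZ) -(rcomm_center _ _ zZ).
by apply: comm_AL => //; apply: comm_LR.
Qed.

Lemma scalC_dichotomy :
  (exists a, [/\ A a, ~ rcenter R a, rcenter R (a ** a) &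
     scalC A = [set c ** Qemb a + c' | c in C & c' in C]])
  \/ commset RC RC `<=` scalC A.
Proof.
have [TA|TA] := EM (T `<=` scalC A).
  right; apply: smallest_sub; first exact: scalC_subgroup.
  move=> _ [x RCx [y RCy <-]]; rewrite rcommE; apply: TA.
  exact: (br_trace0 char2Q ext_centroid_inv RCD (@scalCZ R setT) RC_mul e_frame).
(* Any noncentral element of A serves here. *)
left; have /existsNP[a /not_implyP[Aa aZ]] := A_noncentral; exists a.
have AT : scalC A `<=` T.
  apply: contrapT => AT; case: TA.
  exact: (lie_sub_trace0 char2Q ext_centroid_inv RCD RC_mul RC_prime
    e_frame RC_noncomm (scalC_sub (A := A)) (@scalCD R A) (@scalCZ R A) AC_off AT).
have aZ' : ~ C (Qemb a) by move=> /rcenter_Qemb.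
have [aaZ AE] := lie_sub_trace0_plane char2Q ext_centroid_inv RCD (@scalCZ R setT)
  RC_mul RC_prime e_frame (@scalCD R A) (@scalCZ R A) AC_off (scalC_emb Aa) aZ' AT TA.
by split => //; apply/rcenter_Qemb; rewrite QembMr.
Qed.
End LieIdealAction.

Lemma RC_separable_frame L : nonabelian L -> exists e, separable_frame RC e.
Proof.
move=> Lna; have dimRC := excR.2.
apply: (ex_separable_frame char2Q ext_centroid_inv RCD (@scalCZ R setT) RC_mul
  RC_prime RC_central).
- by move=> s1 s2 s3 s4 S1 S2 S3 S4; apply: RC_dim4_spans.
- have [u [v [Lu Lv uv0]]] := nonabelian_witness Lna.
  exists (Qemb u), (Qemb v); split; try exact: scalC_emb.
  by move=> uv; apply/uv0/Qemb_eq0; rewrite Qemb_rcomm uv char2Q.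
- exact: RC_idempotent dimRC.
Qed.
End ExceptionalRing.

Theorem theoremB (R : primeRngType) (A L : set R) :
  exceptional R ->
  add_subgroup A -> ~ (A `<=` rcenter R) ->
  lie_ideal L -> nonabelian L ->
  commset A L `<=` A ->
  (exists beta : R, [/\ rcenter R beta, beta <> 0 &
     [set beta ** z | z in rcenter R] `<=` A]) /\
  ((exists a : R, [/\ A a, ~ rcenter R a, rcenter R (a ** a) &
      scalC A = [set c ** Qemb a + c' | c in ext_centroid R & c' in ext_centroid R]])
   \/ commset (scalC [set: R]) (scalC [set: R]) `<=` scalC A).
Proof.
move=> excR _ A_nc L_lie L_na AL; have [e e_frame] := RC_separable_frame excR L_na.
split; first exact: (ex_center_multiples excR A_nc L_lie L_na AL e_frame).
exact: (scalC_dichotomy excR A_nc L_lie L_na AL e_frame).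
Qed.
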